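(* The maps $\Theta^{\star}_{I,J}:\mathsf{R}(I\sqcup J)\to\mathsf{R}(I\sqcup\{\star\})\otimes\mathsf{R}(J)$, for finite sets $I,J$, define a cooperad structure on $\mathsf{R}$.
   Context: The ground field is $\mathbb{C}$. Everything is $(\mathbb{Z},\mathbb{Z})$-bigraded, and Koszul signs are taken with respect to the first degree only. ''Antisymmetric'' means $a_{i,j}=-a_{j,i}$, $b_{i,j}=-b_{j,i}$. For a finite set $I$, $\mathsf{R}(I)$ is the unital (graded-)commutative associative algebra generated by elements $a_{i,j}$ antisymmetric of degree $(0,1)$ and $b_{i,j}$ antisymmetric of degree $(1,1)$, for all pairs of distinct elements $i,j$ of $I$, modulo the following relations (all displayed indices being pairwise distinct elements of $I$): $$a_{i,j}^2=0,$$ $$a_{i,j}a_{j,k}+a_{j,k}a_{k,i}+a_{k,i}a_{i,j}=0,$$ $$b_{i,j}a_{j,k}+b_{j,k}a_{k,i}+b_{k,i}a_{i,j}+a_{i,j}b_{j,k}+a_{j,k}b_{k,i}+a_{k,i}b_{i,j}=0,$$ $$a_{i_0,i_1}b_{i_1,i_2}b_{i_2,i_3}\cdots b_{i_n,i_0}=0\ (n\ge1),\qquad b_{i_0,i_1}b_{i_1,i_2}b_{i_2,i_3}\cdots b_{i_n,i_0}=0\ (n\ge1),$$ and the two 12-term relations $$\sum_{w}b_{w_1,w_2}a_{w_2,w_3}b_{w_3,w_4}=0,\qquad \sum_{w}b_{w_1,w_2}b_{w_2,w_3}b_{w_3,w_4}=0,$$ where $w=(w_1,w_2,w_3,w_4)$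 runs over the 12 words $ijk\ell$, $ikj\ell$, $ij\ell k$, $i\ell jk$, $ik\ell j$, $i\ell kj$, $jik\ell$, $jki\ell$, $ji\ell k$, $j\ell ik$, $kij\ell$, $kji\ell$ (representatives of the permutations of $\{i,j,k,\ell\}$ up to reversal). $\mathsf{R}$ is a functor on finite sets and bijections by relabelling. $\Theta^{\star}_{I,J}:\mathsf{R}(I\sqcup J)\to\mathsf{R}(I\sqcup\{\star\})\otimes\mathsf{R}(J)$ is the morphism of algebras given on generators, for $c\in\{a,b\}$, by: $\Theta^{\star}_{I,J}(c_{i,j})=c_{i,j}\otimes1$ if $i,j\in I$; $1\otimes c_{i,j}$ if $i,j\in J$; $c_{i,\star}\otimes1$ if $i\in I$ and $j\in J$. A cooperad structure (the notion dual to an operad with partial compositions) means that the maps $\Theta$ are natural with respect to bijections and that for all finite sets $I,J,K$: $$(\Theta^{\star}_{I,J\sqcup\{\#\}}\otimes\mathrm{Id}_K)\circ\Theta^{\#}_{I\sqcup J,K}=(\mathrm{Id}_{I\sqcup\{\star\}}\otimes\Theta^{\#}_{J,K})\circ\Theta^{\star}_{I,J\sqcup K},$$ $$(\Theta^{\star}_{I\sqcup\{\#\},J}\otimes\mathrm{Id}_K)\circ\Theta^{\#}_{I\sqcup J,K}=(\mathrm{Id}\otimes\tau)\circ(\Theta^{\#}_{I\sqcup\{\star\},K}\otimes\mathrm{Id}_J)\circ\Theta^{\star}_{I\sqcup K,J},$$ where $\mathrm{Id}_K$, $\mathrm{Id}_J$, $\mathrm{Id}_{I\sqcup\{\star\}}$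 are identities of the corresponding algebras $\mathsf{R}(\cdot)$, the last $\mathrm{Id}$ is that of $\mathsf{R}(I\sqcup\{\star,\#\})$, and $\tau$ is the symmetry isomorphism exchanging $\mathsf{R}(K)$ and $\mathsf{R}(J)$. *)

(* Defs.v *)
From HB Require Import structures.
From mathcomp Require Import all_boot all_algebra ring_quotient.
From mathcomp Require Import boolp classical_sets reals complex finmap monalg zify.

Set Implicit Arguments.
Unset Strict Implicit.
Unset Printing Implicit Defensive.

Import GRing.Theory.
Local Open Scope ring_scope.
Local Open Scope quotient_scope.

(* ------------------------------------------------------------------ *)
Section Lin.
Variables (F : fieldType) (V W : lmodType F) (f : V -> W).
Hypothesis fL : linear f.

Lemma linP c x y : f (c *: x + y) = c *: f x + f y. Proof. exact: fL. Qed.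
Lemma lin0 : f 0 = 0.
Proof. by have := fL (-1) 0 0; rewrite !scaleN1r !addNr. Qed.
Lemma linD x y : f (x + y) = f x + f y.
Proof. by rewrite -[x in LHS]scale1r fL scale1r. Qed.
Lemma linZ c x : f (c *: x) = c *: f x.
Proof. by rewrite -[c *: x]addr0 fL lin0 addr0. Qed.
Lemma linB x y : f (x - y) = f x - f y.
Proof. by rewrite addrC -scaleN1r fL scaleN1r addrC. Qed.
Lemma lin_sum (I : Type) (r : seq I) (P : pred I) (g : I -> V) :
  f (\sum_(i <- r | P i) g i) = \sum_(i <- r | P i) f (g i).
Proof. by elim/big_rec2: _ => [|i y z _ <-]; rewrite ?lin0 ?linD. Qed.
End Lin.

Lemma lin_comp (F : fieldType) (U V W : lmodType F) (g : V -> W) (f : U -> V) :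
  linear f -> linear g -> linear (fun x => g (f x)).
Proof. by move=> fL gL c x y; rewrite fL gL. Qed.

Lemma lin_zero (F : fieldType) (U V : lmodType F) : linear (fun _ : U => 0 : V).
Proof. by move=> c x y; rewrite scaler0 addr0. Qed.

(* ------------------------------------------------------------------ *)
Section Quotient.
Variables (F : fieldType) (V : lmodType F) (S : V -> Prop).

Inductive span : V -> Prop :=
| span0 : span 0
| span_gen x of S x : span x
| spanD x y of span x & span y : span (x + y)
| spanZ c x of span x : span (c *: x).

Definition spanb : {pred V} := fun x => `[<span x>].

Lemma spanbP x : reflect (span x) (x \in spanb).
Proof. by rewrite unfold_in; apply: asboolP. Qed.

Lemma spanN x : span x -> span (- x).
Proof. by rewrite -scaleN1r; apply: spanZ. Qed.

Lemma spanb_zmod : zmod_closed spanb.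
Proof.
split=> [|x y /spanbP Sx /spanbP Sy]; apply/spanbP; first exact: span0.
by apply: spanD => //; apply: spanN.
Qed.
HB.instance Definition _ := GRing.isZmodClosed.Build V spanb spanb_zmod.

(* The quotient of [V] by the subspace spanned by [S]. *)
Definition quotl : Type := Quotient.quot spanb.
HB.instance Definition _ := GRing.Zmodule.copy quotl (Quotient.quot spanb).

Definition qpi (x : V) : quotl := \pi_(Quotient.quot spanb) x.
Definition qrepr (q : quotl) : V := repr (q : Quotient.quot spanb).

Lemma qreprK q : qpi (qrepr q) = q.
Proof. exact: reprK. Qed.

Lemma qpi_eq x y : span (x - y) <-> qpi x = qpi y.
Proof.
rewrite /qpi; split=> [/spanbP|/eqP].
  by rewrite Quotient.idealrBE => /eqP.
by rewrite -Quotient.idealrBE => /spanbP.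
Qed.

Lemma qpiD x y : qpi (x + y) = qpi x + qpi y.
Proof. by rewrite /qpi !piE. Qed.

Definition qscale c q := qpi (c *: qrepr q).

Lemma qscaleE c x : qscale c (qpi x) = qpi (c *: x).
Proof.
by apply/qpi_eq; rewrite -scalerBr; apply: spanZ; apply/qpi_eq; rewrite qreprK.
Qed.

Fact qscaleA c d q : qscale c (qscale d q) = qscale (c * d) q.
Proof. by rewrite -[q]qreprK !qscaleE scalerA. Qed.
Fact qscale1 : left_id 1 qscale.
Proof. by move=> q; rewrite -[q]qreprK !qscaleE scale1r. Qed.
Fact qscaleDr : right_distributive qscale +%R.
Proof.
by move=> c p q; rewrite -[p]qreprK -[q]qreprK -qpiD !qscaleE scalerDr qpiD.
Qed.
Fact qscaleDl q : {morph qscale^~ q : a b / a + b}.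
Proof. by move=> c d; rewrite -[q]qreprK !qscaleE scalerDl qpiD. Qed.
HB.instance Definition _ :=
  GRing.Zmodule_isLmodule.Build F quotl qscaleA qscale1 qscaleDr qscaleDl.

Lemma qpi_linear : linear qpi.
Proof. by move=> c x y; rewrite qpiD -qscaleE. Qed.

Lemma qpi0 x : span x -> qpi x = 0.
Proof. by move=> Sx; rewrite -(lin0 qpi_linear); apply/qpi_eq; rewrite subr0. Qed.

(* The map induced by [f]; only meaningful when [f] is linear and vanishes
   on [S]. *)
Definition qlift (W : Type) (f : V -> W) (q : quotl) : W := f (qrepr q).

Section Lift.
Variables (W : lmodType F) (f : V -> W).
Hypotheses (fL : linear f) (fS : forall x, S x -> f x = 0).

Lemma lift_span x : span x -> f x = 0.
Proof.
elim=> [|y /fS//|y z _ y0 _ z0|c y _ y0]; first exact: lin0.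
- by rewrite (linD fL) y0 z0 addr0.
- by rewrite (linZ fL) y0 scaler0.
Qed.

Lemma qliftE x : qlift f (qpi x) = f x.
Proof.
apply/eqP; rewrite -subr_eq0 -(linB fL); apply/eqP/lift_span/qpi_eq.
exact: qreprK.
Qed.

Lemma qlift_linear : linear (qlift f).
Proof.
move=> c p q; rewrite -[p]qreprK -[q]qreprK -qpi_linear !qliftE; exact: fL.
Qed.
End Lift.
End Quotient.

(* Used to show that 1 ⊗ 1 is nonzero. *)
Section Functional.
Local Open Scope classical_set_scope.
Variables (F : fieldType) (V : lmodType F) (v : V).
Hypothesis v0 : v != 0.

Lemma span_add (A : set V) x z : span (A `|` [set x])%classic z ->
  exists c s, span A s /\ z = s + c *: x.
Proof.
elim=> {z} [|z [Az|->]|y z _ [c [s [As ->]]] _ [d [t [At ->]]]|c y _ [d [s [As ->]]]].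
- by exists 0, 0; split; [exact: span0 | rewrite scale0r addr0].
- by exists 0, z; split; [exact: span_gen | rewrite scale0r addr0].
- by exists 1, 0; split; [exact: span0 | rewrite scale1r add0r].
- exists (c + d), (s + t); split; first exact: spanD.
  by rewrite scalerDl addrACA.
- exists (c * d), (c *: s); split; first exact: spanZ.
  by rewrite scalerDr scalerA.
Qed.

Lemma span_mono (A B : set V) x : (A `<=` B) -> span A x -> span B x.
Proof.
move=> AB; elim=> {x} [|x Ax|x y _ Bx _ By|c x _ Bx].
- exact: span0. - by apply/span_gen/AB. - exact: spanD. - exact: spanZ.
Qed.

Lemma span_bigcup (G : set (set V)) x : total_on G subset ->
  span (\bigcup_(A in G) A)%classic x -> x = 0 \/ exists2 A, G A & span A x.
Proof.
move=> Gt; elim=> {x} [|x [A GA Ax]|x y _ hx _ hy|c x _ [->|[A GA Ax]]].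
- by left.
- by right; exists A => //; apply: span_gen.
- case: hx => [->|[A GA Ax]]; first by rewrite add0r.
  case: hy => [->|[B GB By]]; first by rewrite addr0; right; exists A.
  right; case: (Gt _ _ GA GB) => [AB|BA].
    by exists B => //; apply: spanD => //; apply: span_mono Ax.
  by exists A => //; apply: spanD => //; apply: span_mono By.
- by left; rewrite scaler0.
- by right; exists A => //; apply: spanZ.
Qed.

Lemma exists_functional : exists f : V -> F^o, linear f /\ f v = 1.
Proof.
have [|A [Av Amax]] := @Zorn_bigcup V [set A | ~ span A v].
  move=> G GP Gt /(span_bigcup Gt)[/eqP|[A /GP]//].
  by rewrite (negPf v0).
have ex x : exists c, span A (x - c *: v).
  case: (pselect (span A x)) => [Ax|nAx].
    by exists 0; rewrite scale0r subr0.
  have /Amax/contrapT/span_add[c [s [As vE]]] : (A `<` A `|` [set x]).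
    split; first by move=> y Ay; left.
    by move=> /(_ x (or_intror erefl)) Ax; apply/nAx/span_gen.
  have [c0|c0] := eqVneq c 0.
    by case: Av; rewrite vE c0 scale0r addr0.
  exists c^-1; rewrite {1}vE scalerDr scalerA mulVf // scale1r.
  by rewrite opprD addrCA subrr addr0 -scaleNr; apply: spanZ.
have [f fP] := choice ex.
have uni x c d : span A (x - c *: v) -> span A (x - d *: v) -> c = d.
  move=> /spanN cx /(spanD cx); rewrite opprB addrA subrK -scalerBl => cd.
  apply/eqP; rewrite -subr_eq0; apply/negP => /negP nz; apply: Av.
  by rewrite -[v]scale1r -(mulVf nz) -scalerA; apply: spanZ.
exists f; split=> [c x y|]; apply: uni (fP _) _.
  rewrite scalerDl opprD addrACA; apply: spanD (fP y).
  by rewrite -scalerA -scalerBr; apply: spanZ.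
by rewrite scale1r subrr; apply: span0.
Qed.
End Functional.

(* ------------------------------------------------------------------ *)
Section LinearExtension.
Variables (F : fieldType) (K : choiceType) (V : lmodType F) (h : K -> V).

Definition linext (g : {malg F[K]}) : V := \sum_(k <- msupp g) g@_k *: h k.

Lemma linextEw (D : {fset K}) (g : {malg F[K]}) : (msupp g `<=` D)%fset ->
  linext g = \sum_(k <- D) g@_k *: h k.
Proof.
move=> sgD; rewrite /linext.
apply: (big_fset_incl _ sgD) => k _ /mcoeff_outdom ->.
by rewrite scale0r.
Qed.

Lemma linext_linear : linear linext.
Proof.
move=> c x y; pose D := (msupp x `|` msupp y)%fset.
have sx : (msupp x `<=` D)%fset by apply: fsubsetUl.
have sy : (msupp y `<=` D)%fset by apply: fsubsetUr.
have sz : (msupp (c *: x + y)%R `<=` D)%fset.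
  apply: fsubset_trans (msuppD_le _ _) _.
  by apply: fsetSU; apply: msuppZ_le.
rewrite (linextEw sx) (linextEw sy) (linextEw sz) scaler_sumr -big_split /=.
by apply: eq_bigr => k _; rewrite mcoeffD mcoeffZ scalerDl scalerA.
Qed.

Lemma linextU k : linext << k >> = h k.
Proof. by rewrite (linextEw msuppU_le) big_seq_fset1 mcoeffUU scale1r. Qed.
End LinearExtension.

Section MalgInd.
Variables (F : fieldType) (K : choiceType).

Lemma malg_lin (g : {malg F[K]}) :
  g = \sum_(k <- msupp g) g@_k *: << k >>.
Proof.
rewrite {1}[g]monalgE; apply: eq_bigr => k _.
by apply/malgP => j; rewrite mcoeffZ !mcoeffU -mulr_natr.
Qed.

Lemma malg_lin_eq (V : lmodType F) (f h : {malg F[K]} -> V) :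
  linear f -> linear h -> (forall k, f << k >> = h << k >>) -> f =1 h.
Proof.
move=> fL hL fh g; rewrite [g]malg_lin (lin_sum fL) (lin_sum hL).
by apply: eq_bigr => k _; rewrite (linZ fL) (linZ hL) fh.
Qed.
End MalgInd.

(* ------------------------------------------------------------------ *)
Definition bideg := (int * int)%type.

(* Koszul signs involve the first degree only. *)
Definition ksign (F : fieldType) (d e : bideg) : F := (-1) ^ (d.1 * e.1).

Lemma N1_neq0 (F : fieldType) : (-1 : F) != 0.
Proof. by rewrite oppr_eq0 oner_eq0. Qed.
Lemma ksignDl F d d' e : ksign F (d + d') e = ksign F d e * ksign F d' e.
Proof. by rewrite /ksign mulrDl expfzDr ?N1_neq0. Qed.
Lemma ksignDr F d e e' : ksign F d (e + e') = ksign F d e * ksign F d e'.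
Proof. by rewrite /ksign mulrDr expfzDr ?N1_neq0. Qed.
Lemma ksign0l F e : ksign F 0 e = 1.
Proof. by rewrite /ksign mul0r expr0z. Qed.
Lemma ksign0r F e : ksign F e 0 = 1.
Proof. by rewrite /ksign mulr0 expr0z. Qed.

(* (Z, Z)-bigraded unital associative algebras, the direct sum decomposition being
   given by the projections [gproj d] onto the components of bidegree [d]. *)
HB.mixin Record isBigraded (F : fieldType) (A : Type)
    of GRing.Algebra F A := {
  gproj : bideg -> A -> A;
  gproj_linear : forall d, linear (gproj d);
  gprojK : forall d e x, gproj d (gproj e x) = if d == e then gproj e x else 0;
  gproj_fin : forall x, exists s : seq bideg,
    uniq s && (x == \sum_(d <- s) gproj d x);
  gproj1 : gproj 0 1 = 1;
  gprojM : forall d e x y,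
    gproj (d + e) (gproj d x * gproj e y) = gproj d x * gproj e y
}.

#[short(type="bgAlgType")]
HB.structure Definition BigradedAlgebra (F : fieldType) :=
  {A of GRing.Algebra F A & isBigraded F A}.

Section FiniteSupport.
Variables (F : fieldType) (A : lmodType F) (p : bideg -> A -> A).
Hypotheses (pL : forall d, linear (p d)).
Hypothesis pK : forall d e x, p d (p e x) = if d == e then p e x else 0.

Lemma sum_sup (V : zmodType) (s t : seq bideg) (f : bideg -> V) :
  uniq s -> uniq t -> {subset s <= t} -> (forall d, d \notin s -> f d = 0) ->
  \sum_(d <- t) f d = \sum_(d <- s) f d.
Proof.
move=> us ut st f0; rewrite (bigID (mem s)) /= addrC big1 ?add0r //.
rewrite -big_filter; apply/perm_big/uniq_perm; rewrite ?filter_uniq //.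
move=> d; rewrite mem_filter; case: (boolP (d \in s)) => //= /st ->.
by [].
Qed.

Definition fin_supp x := exists s : seq bideg, uniq s && (x == \sum_(d <- s) p d x).

Lemma fin_supp0P x s : uniq s -> x = \sum_(d <- s) p d x ->
  forall e, e \notin s -> p e x = 0.
Proof.
move=> us xE e es; rewrite xE (lin_sum (pL e)) big_seq big1 // => d ds.
by rewrite pK; case: eqP => // ed; rewrite ed ds in es.
Qed.

Lemma fin_supp0 : fin_supp 0.
Proof. by exists [::]; rewrite big_nil eqxx. Qed.

Lemma fin_suppH d x : p d x = x -> fin_supp x.
Proof. by move=> dx; exists [:: d]; rewrite big_seq1 dx eqxx. Qed.

Lemma fin_suppD x y : fin_supp x -> fin_supp y -> fin_supp (x + y).
Proof.
move=> [s /andP[us /eqP xE]] [t /andP[ut /eqP yE]].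
exists (undup (s ++ t)); rewrite undup_uniq /=; apply/eqP.
under eq_bigr => d _ do rewrite (linD (pL d)).
rewrite big_split /= {1}xE {1}yE; congr (_ + _); symmetry; apply: sum_sup => //.
- exact: undup_uniq.
- by move=> d ds; rewrite mem_undup mem_cat ds.
- exact: fin_supp0P.
- exact: undup_uniq.
- by move=> d ds; rewrite mem_undup mem_cat ds orbT.
- exact: fin_supp0P.
Qed.

Lemma fin_suppZ c x : fin_supp x -> fin_supp (c *: x).
Proof.
move=> [s /andP[us /eqP xE]]; exists s; rewrite us; apply/eqP.
rewrite {1}xE scaler_sumr; apply: eq_bigr => d _.
by rewrite (linZ (pL d)).
Qed.
End FiniteSupport.

Section BigradedTheory.
Variables (F : fieldType) (A : bgAlgType F).

Definition homog (d : bideg) (x : A) := gproj d x = x.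

(* A finite list of bidegrees containing those of the nonzero components. *)
Definition gsupp (x : A) : seq bideg := xchoose (gproj_fin x).

Lemma gsupp_uniq x : uniq (gsupp x).
Proof. by have /andP[] := xchooseP (gproj_fin x). Qed.
Lemma gsuppE x : x = \sum_(d <- gsupp x) gproj d x.
Proof. by have /andP[_ /eqP] := xchooseP (gproj_fin x). Qed.
Lemma gsupp_out x d : d \notin gsupp x -> gproj d x = 0.
Proof.
exact: (fin_supp0P (@gproj_linear F A) (@gprojK F A) (gsupp_uniq x) (gsuppE x)).
Qed.

Lemma homog_gproj d x : homog d (gproj d x).
Proof. by rewrite /homog gprojK eqxx. Qed.
Lemma homog_out d e x : homog d x -> e != d -> gproj e x = 0.
Proof. by move=> <- /negPf ed; rewrite gprojK ed. Qed.
Lemma homogM d e x y : homog d x -> homog e y -> homog (d + e) (x * y).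
Proof. by move=> <- <-; exact: gprojM. Qed.
Lemma homog0 d : homog d 0. Proof. exact: lin0 (gproj_linear d). Qed.
Lemma homogD d x y : homog d x -> homog d y -> homog d (x + y).
Proof. by rewrite /homog (linD (gproj_linear d)) => -> ->. Qed.
Lemma homogZ d c x : homog d x -> homog d (c *: x).
Proof. by rewrite /homog (linZ (gproj_linear d)) => ->. Qed.
Lemma homog1 : homog 0 1. Proof. exact: gproj1. Qed.

Lemma gsum_homog (V : zmodType) (f : bideg -> A -> V) d x :
  (forall e, f e 0 = 0) -> homog d x ->
  \sum_(e <- gsupp x) f e (gproj e x) = f d x.
Proof.
move=> f0 dx; transitivity (\sum_(e <- [:: d]) f e (gproj e x)); last first.
  by rewrite big_seq1 dx.
pose t := undup (d :: gsupp x).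
rewrite -(@sum_sup _ (gsupp x) t) ?undup_uniq ?gsupp_uniq //.
- apply: sum_sup; rewrite ?undup_uniq //.
    by move=> e; rewrite inE mem_undup in_cons => ->.
  by move=> e; rewrite inE => ed; rewrite (homog_out dx ed).
- by move=> e es; rewrite mem_undup in_cons es orbT.
- by move=> e /gsupp_out ->.
Qed.

Lemma gsum_linear (V : lmodType F) (f : bideg -> A -> V) :
  (forall e, linear (f e)) ->
  linear (fun x => \sum_(e <- gsupp x) f e (gproj e x)).
Proof.
move=> fL c x y; pose t := undup (gsupp (c *: x + y) ++ gsupp x ++ gsupp y).
have E z : {subset gsupp z <= t} ->
  \sum_(e <- gsupp z) f e (gproj e z) = \sum_(e <- t) f e (gproj e z).
  move=> st; rewrite -(@sum_sup _ (gsupp z) t) ?undup_uniq ?gsupp_uniq //.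
  by move=> e /gsupp_out ->; apply: lin0.
rewrite !E; first by rewrite scaler_sumr -big_split; apply: eq_bigr => e _;
  rewrite gproj_linear fL.
all: by move=> e es; rewrite mem_undup !mem_cat es ?orbT.
Qed.

Lemma homog_ind (P : A -> Prop) :
  P 0 -> (forall x y, P x -> P y -> P (x + y)) ->
  (forall d x, homog d x -> P x) -> forall x, P x.
Proof.
move=> P0 PD Ph x; rewrite [x]gsuppE.
by elim/big_rec: _ => // d y _; apply: PD; apply: Ph (homog_gproj d x).
Qed.

Lemma mull_linear (x : A) : linear ( *%R x).
Proof. by move=> c y z; rewrite mulrDr scalerAr. Qed.
Lemma mulr_linear (x : A) : linear ( *%R^~ x).
Proof. by move=> c y z; rewrite mulrDl scalerAl. Qed.
End BigradedTheory.

Section Bilinear.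
Variable F : fieldType.

Definition bilin (U V W : lmodType F) (f : U -> V -> W) :=
  (forall v, linear (f^~ v)) /\ (forall u, linear (f u)).

(* [sum_{d, e} w d e *: f x_d y_e], over the components of [x] and [y]. *)
Definition wsum (w : bideg -> bideg -> F) (A B : bgAlgType F) (V : lmodType F)
    (f : A -> B -> V) (x : A) (y : B) : V :=
  \sum_(d <- gsupp x) \sum_(e <- gsupp y) w d e *: f (gproj d x) (gproj e y).

Variables (w : bideg -> bideg -> F) (A B : bgAlgType F) (V : lmodType F).
Variables (f : A -> B -> V).
Hypothesis fB : bilin f.

Lemma wsum_bilin : bilin (wsum w f).
Proof.
case: fB => fl fr; split=> [y|x].
  apply: (@gsum_linear _ _ _
    (fun d x => \sum_(e <- gsupp y) w d e *: f x (gproj e y))) => d c x x'.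
  rewrite scaler_sumr -big_split; apply: eq_bigr => e _ /=.
  by rewrite fl scalerDr !scalerA mulrC.
move=> c y y'; rewrite /wsum scaler_sumr -big_split; apply: eq_bigr => d _ /=.
pose g e z := w d e *: f (gproj d x) z.
apply: (@gsum_linear _ _ _ g) => e k z z'.
by rewrite /g fr scalerDr !scalerA mulrC.
Qed.

Lemma wsumE d e x y : homog d x -> homog e y -> wsum w f x y = w d e *: f x y.
Proof.
case: fB => fl fr dx ey.
rewrite /wsum (@gsum_homog _ _ _
  (fun d x => \sum_(e <- gsupp y) w d e *: f x (gproj e y)) d) //.
  rewrite (@gsum_homog _ _ _ (fun e y => w d e *: f x y) e) // => e'.
  by rewrite (lin0 (fr _)) scaler0.
move=> d'; rewrite big1 // => e' _; rewrite (lin0 (fl _)) scaler0 //.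
Qed.
End Bilinear.

(* ------------------------------------------------------------------ *)
(* The tensor product of vector spaces: the free vector space on A * B modulo
   bilinearity. *)
Section TensorSpace.
Variables (F : fieldType) (A B : lmodType F).

Inductive tens_rel : {malg F[(A * B)%type]} -> Prop :=
| tens_Dl x x' y : tens_rel (<< (x + x', y) >> - << (x, y) >> - << (x', y) >>)
| tens_Dr x y y' : tens_rel (<< (x, y + y') >> - << (x, y) >> - << (x, y') >>)
| tens_Zl c x y : tens_rel (<< (c *: x, y) >> - c *: << (x, y) >>)
| tens_Zr c x y : tens_rel (<< (x, c *: y) >> - c *: << (x, y) >>).

Definition tens : Type := quotl tens_rel.
HB.instance Definition _ := GRing.Lmodule.on tens.

Definition pure (x : A) (y : B) : tens := qpi tens_rel << (x, y) >>.

Lemma pure_bilin : bilin pure.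
Proof.
have qL := qpi_linear tens_rel.
have E (S := tens_rel) x y : span S (x - y) -> qpi S x = qpi S y by move/qpi_eq.
split=> [y c x x'|x c y y'].
  rewrite /pure; transitivity (qpi tens_rel (<<(c *: x, y)>> + <<(x', y)>>)).
    by apply: E; rewrite opprD addrA; apply/span_gen/tens_Dl.
  rewrite (linD qL); congr (_ + _); rewrite -(linZ qL).
  by apply/E/span_gen/tens_Zl.
rewrite /pure; transitivity (qpi tens_rel (<<(x, c *: y)>> + <<(x, y')>>)).
  by apply: E; rewrite opprD addrA; apply/span_gen/tens_Dr.
rewrite (linD qL); congr (_ + _); rewrite -(linZ qL).
by apply/E/span_gen/tens_Zr.
Qed.

Lemma tens_ind (P : tens -> Prop) :
  P 0 -> (forall t u, P t -> P u -> P (t + u)) ->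
  (forall x y, P (pure x y)) -> forall t, P t.
Proof.
move=> P0 PD Pp t; rewrite -[t]qreprK [qrepr t]malg_lin.
rewrite (lin_sum (qpi_linear _)).
elim/big_rec: _ => // -[x y] u _; apply: PD.
rewrite (linZ (qpi_linear _)) -/(pure x y).
by case: pure_bilin => /(_ y) /linZ <- _; apply: Pp.
Qed.

(* The linear map induced by a bilinear map [f]. *)
Definition tlift (W : lmodType F) (f : A -> B -> W) : tens -> W :=
  @qlift _ _ tens_rel _ (linext (fun p => f p.1 p.2)).

Section Lift.
Variables (W : lmodType F) (f : A -> B -> W).
Hypothesis fB : bilin f.

Let L := linext_linear (fun p => f p.1 p.2).

Lemma tlift_rel x : tens_rel x -> linext (fun p => f p.1 p.2) x = 0.
Proof.
case: fB => fl fr.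
case=> [x1 x2 y|x1 y1 y2|c x1 y|c x1 y]; rewrite !(linB L) ?(linZ L) !linextU /=.
- by rewrite (linD (fl y)) addrAC addrK subrr.
- by rewrite (linD (fr x1)) addrAC addrK subrr.
- by rewrite (linZ (fl y)) subrr.
- by rewrite (linZ (fr x1)) subrr.
Qed.

Lemma tliftE x y : tlift f (pure x y) = f x y.
Proof. by rewrite /tlift /pure qliftE ?linextU //; apply: tlift_rel. Qed.

Lemma tlift_linear : linear (tlift f).
Proof. by apply: qlift_linear => //; apply: tlift_rel. Qed.
End Lift.
End TensorSpace.

Arguments tens {F} (A B)%_type.
Notation "A ⊗ B" := (tens A B) (at level 40, left associativity) : type_scope.
Notation "x ⊗ y" := (pure x y) (at level 40, left associativity) : ring_scope.

(* ------------------------------------------------------------------ *)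
Section TensorAlgebra.
Variables (F : fieldType) (A B : bgAlgType F).
Notation T := (A ⊗ B)%type.

Lemma pureDl x x' (y : B) : (x + x' : A) ⊗ y = x ⊗ y + x' ⊗ y.
Proof. by case: (pure_bilin A B) => /(_ y) /linD. Qed.
Lemma pureDr (x : A) (y y' : B) : x ⊗ (y + y') = x ⊗ y + x ⊗ y'.
Proof. by case: (pure_bilin A B) => _ /(_ x) /linD. Qed.
Lemma pure0l (y : B) : (0 : A) ⊗ y = 0.
Proof. by case: (pure_bilin A B) => /(_ y) /lin0. Qed.
Lemma pure0r (x : A) : x ⊗ (0 : B) = 0.
Proof. by case: (pure_bilin A B) => _ /(_ x) /lin0. Qed.
Lemma pureZl c x (y : B) : (c *: x : A) ⊗ y = c *: (x ⊗ y).
Proof. by case: (pure_bilin A B) => /(_ y) /linZ. Qed.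
Lemma pureZr c (x : A) (y : B) : x ⊗ (c *: y) = c *: (x ⊗ y).
Proof. by case: (pure_bilin A B) => _ /(_ x) /linZ. Qed.

Lemma tens_indh (P : T -> Prop) :
  P 0 -> (forall t u, P t -> P u -> P (t + u)) ->
  (forall d e x y, homog d x -> homog e y -> P (x ⊗ y)) -> forall t, P t.
Proof.
move=> P0 PD Ph; apply: tens_ind => // x y; move: x.
apply: homog_ind => [|x x' Px Px'|d x dx]; rewrite ?pure0l ?pureDl //.
  exact: PD.
move: y; apply: homog_ind => [|y y' Py Py'|e y ey]; rewrite ?pure0r ?pureDr //.
  exact: PD.
exact: Ph dx ey.
Qed.

Lemma tens_lin_eq (W : lmodType F) (f g : T -> W) : linear f -> linear g ->
  (forall d e x y, homog d x -> homog e y -> f (x ⊗ y) = g (x ⊗ y)) -> f =1 g.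
Proof.
move=> fL gL fg; apply: tens_indh => [|t u ft fu|//].
  by rewrite (lin0 fL) (lin0 gL).
by rewrite (linD fL) (linD gL) ft fu.
Qed.

Definition tproj (d : bideg) : T -> T :=
  tlift (wsum (fun e e' => (e + e' == d)%:R) (@pure F A B)).

(* Koszul rule: (x ⊗ y)(x' ⊗ y') = (-1)^(|y||x'|) (x x') ⊗ (y y'). *)
Definition tmulp (x : A) (y : B) (x' : A) (y' : B) : T :=
  wsum (@ksign F) (fun v u => (x * u) ⊗ (v * y')) y x'.

Definition tmul_pure (t : T) (x' : A) (y' : B) : T :=
  tlift (fun x y => tmulp x y x' y') t.

Definition tmul (t t' : T) : T := tlift (tmul_pure t) t'.

Definition tone : T := 1 ⊗ 1.

Lemma tproj_linear d : linear (tproj d).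
Proof. by apply/tlift_linear/wsum_bilin/pure_bilin. Qed.

Lemma tprojE d e e' x y : homog e x -> homog e' y ->
  tproj d (x ⊗ y) = if e + e' == d then x ⊗ y else 0.
Proof.
move=> ex ey; rewrite /tproj tliftE; last exact/wsum_bilin/pure_bilin.
rewrite (wsumE _ (pure_bilin A B) ex ey).
by case: eqP; rewrite ?scale1r ?scale0r.
Qed.

Lemma tmulp_aux x y' : bilin (fun (v : B) (u : A) => (x * u) ⊗ (v * y')).
Proof.
split=> [u|v] c z z'.
  by rewrite mulrDl pureDr -scalerAl pureZr.
by rewrite mulrDr pureDl -scalerAr pureZl.
Qed.

Lemma tmulpE d e x y x' y' : homog d y -> homog e x' ->
  tmulp x y x' y' = ksign F d e *: ((x * x') ⊗ (y * y')).
Proof. by move=> dy ex'; rewrite /tmulp (wsumE _ (tmulp_aux x y') dy ex'). Qed.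

Lemma wsum_lin w (U V : lmodType F) (f : U -> B -> A -> V) (y : B) (x : A) :
  (forall v u, linear (fun x => f x v u)) ->
  linear (fun z => wsum w (f z) y x).
Proof.
move=> fL c z z'; rewrite /wsum scaler_sumr -big_split; apply: eq_bigr => d _.
rewrite /= scaler_sumr -big_split; apply: eq_bigr => e _ /=.
by rewrite fL scalerDr !scalerA mulrC.
Qed.

Lemma tmulp_bilinl x' y' : bilin (fun x y => tmulp x y x' y').
Proof.
split=> [y|x].
  apply: (@wsum_lin _ _ _ (fun x v u => (x * u) ⊗ (v * y'))) => v u c z z'.
  by rewrite mulrDl pureDl -scalerAl pureZl.
exact: (wsum_bilin (@ksign F) (tmulp_aux x y')).1.
Qed.

Lemma tmulp_bilinr x y : bilin (tmulp x y).
Proof.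
split=> [y'|x'].
  exact: (wsum_bilin (@ksign F) (tmulp_aux x y')).2.
apply: (@wsum_lin _ _ _ (fun y' v u => (x * u) ⊗ (v * y'))) => v u c z z'.
by rewrite mulrDr pureDr -scalerAr pureZr.
Qed.

Lemma tmul_pureL x' y' : linear (fun t => tmul_pure t x' y').
Proof. exact: tlift_linear (tmulp_bilinl x' y'). Qed.

Lemma tmul_pure0 x' y' : tmul_pure 0 x' y' = 0.
Proof. exact: lin0 (tmul_pureL x' y'). Qed.
Lemma tmul_pureD t u x' y' :
  tmul_pure (t + u) x' y' = tmul_pure t x' y' + tmul_pure u x' y'.
Proof. exact: linD (tmul_pureL x' y') t u. Qed.
Lemma tmul_pureE x y x' y' : tmul_pure (x ⊗ y) x' y' = tmulp x y x' y'.
Proof. exact: tliftE (tmulp_bilinl x' y') x y. Qed.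

Lemma tmul_aux t : bilin (tmul_pure t).
Proof.
split=> [y'|x'] c z z'; move: t; apply: tens_ind => [|t u ht hu|x y].
- by rewrite !tmul_pure0 scaler0 addr0.
- by rewrite !tmul_pureD ht hu scalerDr addrACA.
- by rewrite !tmul_pureE; exact: (tmulp_bilinr x y).1.
- by rewrite !tmul_pure0 scaler0 addr0.
- by rewrite !tmul_pureD ht hu scalerDr addrACA.
- by rewrite !tmul_pureE; exact: (tmulp_bilinr x y).2.
Qed.

Lemma tmul0r t : tmul t 0 = 0.
Proof. exact: lin0 (tlift_linear (tmul_aux t)). Qed.
Lemma tmulD_r t u v : tmul t (u + v) = tmul t u + tmul t v.
Proof. exact: linD (tlift_linear (tmul_aux t)) u v. Qed.
Lemma tmul_pE t x y : tmul t (x ⊗ y) = tmul_pure t x y.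
Proof. exact: tliftE (tmul_aux t) x y. Qed.

Lemma tmul_bilin : bilin tmul.
Proof.
split=> [t'|t]; last exact: tlift_linear (tmul_aux t).
move=> c t u; move: t'; apply: tens_ind => [|v w hv hw|x y].
- by rewrite !tmul0r scaler0 addr0.
- by rewrite !tmulD_r hv hw scalerDr addrACA.
- by rewrite !tmul_pE; exact: tmul_pureL.
Qed.

Lemma tmulE d e x y x' y' : homog d y -> homog e x' ->
  tmul (x ⊗ y) (x' ⊗ y') = ksign F d e *: ((x * x') ⊗ (y * y')).
Proof. by move=> dy ex'; rewrite tmul_pE tmul_pureE; exact: tmulpE. Qed.

Let tmull t := tmul_bilin.2 t.
Let tmulr t := tmul_bilin.1 t.

Fact tmulA : associative tmul.
Proof.
move=> t u v; move: t; apply: tens_lin_eq.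
- exact: tmulr.
- exact: lin_comp (tmulr u) (tmulr v).
move=> d1 e1 x1 y1 hx1 hy1; move: u; apply: tens_lin_eq.
- exact: lin_comp (tmulr v) (tmull _).
- exact: lin_comp (tmull _) (tmulr v).
move=> d2 e2 x2 y2 hx2 hy2; move: v; apply: tens_lin_eq.
- exact: lin_comp (tmull _) (tmull _).
- exact: tmull.
move=> d3 e3 x3 y3 hx3 hy3.
rewrite (tmulE _ _ hy2 hx3) (tmulE _ _ hy1 hx2) (linZ (tmull _)) (linZ (tmulr _)).
rewrite (tmulE _ _ hy1 (homogM hx2 hx3)) (tmulE _ _ (homogM hy1 hy2) hx3).
by rewrite !scalerA !mulrA ksignDl ksignDr; congr (_ *: _); rewrite mulrC -!mulrA;
   congr (_ * _); rewrite mulrC.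
Qed.

Fact tmul1 : left_id tone tmul.
Proof.
apply: (@tens_lin_eq _ (tmul tone) id) => //.
by move=> d e x y hx hy; rewrite (tmulE _ _ (homog1 _) hx) ksign0l scale1r !mul1r.
Qed.

Fact tmul1r : right_id tone tmul.
Proof.
apply: (@tens_lin_eq _ (tmul^~ tone) id) => //.
by move=> d e x y hx hy; rewrite (tmulE _ _ hy (homog1 _)) ksign0r scale1r !mulr1.
Qed.

Fact tmulDl : left_distributive tmul +%R.
Proof. by move=> t u v; rewrite (linD (tmulr v)). Qed.
Fact tmulDr : right_distributive tmul +%R.
Proof. by move=> t u v; rewrite (linD (tmull t)). Qed.

Fact tone_neq0 : tone != 0.
Proof.
have [f [fL f1]] := exists_functional (oner_neq0 A).
have [g [gL g1]] := exists_functional (oner_neq0 B).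
have fgB : bilin (fun x y => f x * g y : F^o).
  split=> [y|x] c z z'; first by rewrite fL mulrDl -scalerAl.
  by rewrite gL mulrDr -scalerAr.
apply/eqP => /(congr1 (tlift (fun x y => f x * g y : F^o))).
rewrite (lin0 (tlift_linear fgB)) (tliftE fgB) f1 g1 mulr1.
by apply/eqP/oner_neq0.
Qed.

HB.instance Definition _ := GRing.Lmodule.on T.
HB.instance Definition _ :=
  GRing.Zmodule_isNzRing.Build T tmulA tmul1 tmul1r tmulDl tmulDr tone_neq0.

Fact tscalerAl (c : F) (t u : T) : c *: (t * u) = (c *: t) * u.
Proof. by rewrite [RHS](linZ (tmulr u)). Qed.
HB.instance Definition _ := GRing.Lmodule_isLalgebra.Build F T tscalerAl.
Fact tscalerAr (c : F) (t u : T) : c *: (t * u) = t * (c *: u).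
Proof. by rewrite [RHS](linZ (tmull t)). Qed.
HB.instance Definition _ := GRing.Lalgebra_isAlgebra.Build F T tscalerAr.

Fact tprojK d e t : tproj d (tproj e t) = if d == e then tproj e t else 0.
Proof.
move: t; apply: tens_lin_eq.
- exact: lin_comp (tproj_linear e) (tproj_linear d).
- case: eqP => _; [exact: tproj_linear | exact: lin_zero].
move=> d1 e1 x y hx hy; rewrite !(tprojE _ hx hy).
have [<-|ne] := eqVneq (d1 + e1) e.
  by rewrite (tprojE _ hx hy) eq_sym.
by rewrite (lin0 (tproj_linear d)) if_same.
Qed.

Fact tproj_fin t : exists s : seq bideg, uniq s && (t == \sum_(d <- s) tproj d t).
Proof.
move: t; apply: tens_indh; first exact: fin_supp0.
  exact: fin_suppD tproj_linear tprojK.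
move=> d e x y hx hy; apply: (@fin_suppH _ _ tproj (d + e)).
by rewrite (tprojE _ hx hy) eqxx.
Qed.

Fact tproj1 : tproj 0 1 = 1.
Proof. by rewrite (tprojE _ (homog1 A) (homog1 B)) addr0 eqxx. Qed.

Fact tprojM d e (t u : T) :
  tproj (d + e) (tproj d t * tproj e u) = tproj d t * tproj e u.
Proof.
move: t; apply: (@tens_lin_eq _ (fun t => tproj (d + e) (tproj d t * tproj e u))
   (fun t => tproj d t * tproj e u)).
- by apply: lin_comp (tproj_linear _); apply: lin_comp (tproj_linear d) (tmulr _).
- exact: lin_comp (tproj_linear d) (tmulr _).
move=> d1 e1 x1 y1 hx1 hy1; rewrite (tprojE _ hx1 hy1).
case: eqP => [<-|_]; last by rewrite !mul0r (lin0 (tproj_linear _)).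
move: u; apply: (@tens_lin_eq _
   (fun u => tproj (d1 + e1 + e) (x1 ⊗ y1 * tproj e u))
   (fun u => x1 ⊗ y1 * tproj e u)).
- by apply: lin_comp (tproj_linear _); apply: lin_comp (tproj_linear _) (tmull _).
- exact: lin_comp (tproj_linear _) (tmull _).
move=> d2 e2 x2 y2 hx2 hy2; rewrite (tprojE _ hx2 hy2).
case: eqP => [<-|_]; last by rewrite !mulr0 (lin0 (tproj_linear _)).
rewrite [_ * _](tmulE _ _ hy1 hx2) (linZ (tproj_linear _)).
by rewrite (tprojE _ (homogM hx1 hx2) (homogM hy1 hy2)) addrACA eqxx.
Qed.

HB.instance Definition _ := isBigraded.Build F T
  tproj_linear tprojK tproj_fin tproj1 tprojM.

Lemma tens_mulE d e (x : A) (y : B) (x' : A) (y' : B) :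
  homog d y -> homog e x' ->
  (x ⊗ y) * (x' ⊗ y') = ksign F d e *: ((x * x') ⊗ (y * y')) :> T.
Proof. exact: tmulE. Qed.

Lemma homog_pure d e (x : A) (y : B) : homog d x -> homog e y ->
  homog (d + e) (x ⊗ y : T).
Proof. by move=> hx hy; rewrite /homog [LHS](tprojE _ hx hy) eqxx. Qed.
End TensorAlgebra.

(* ------------------------------------------------------------------ *)
Section FreeAlgebra.
Variables (F : fieldType) (G : choiceType).

Notation fralg := {malg F[{fmonom G}]}.

Lemma malg_ind (Q : fralg -> Prop) :
  Q 0 -> (forall x y, Q x -> Q y -> Q (x + y)) ->
  (forall c w, Q (c *: << w >>)) -> forall x, Q x.
Proof.
move=> Q0 QD QZ x; rewrite [x]malg_lin.
by elim/big_rec: _ => // w y _; apply: QD.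
Qed.

Lemma malgUM (w w' : {fmonom G}) :
  << w >> * << w' >> = << mmul w w' >> :> fralg.
Proof. by rewrite malgM_def fgmulUU mulr1. Qed.

Lemma frscalerAr (c : F) (x y : fralg) : c *: (x * y) = x * (c *: y).
Proof.
suff cC : x * c%:MP = c *: x by rewrite -[c *: y]mul_malgC mulrA cC scalerAl.
move: x; apply: malg_lin_eq => [d x x'|d x x'|w].
- by rewrite mulrDl -scalerAl.
- by rewrite scalerDr !scalerA mulrC.
by rewrite -mul_malgC !malgM_def !fgmulUU mulr1 mul1r mulm1 mul1m.
Qed.

Lemma frmull_linear (x : fralg) : linear ( *%R x).
Proof. by move=> c y z; rewrite mulrDr frscalerAr. Qed.
Lemma frmulr_linear (x : fralg) : linear ( *%R^~ x).
Proof. by move=> c y z; rewrite mulrDl scalerAl. Qed.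

Variable deg : G -> bideg.

Definition wdeg (w : {fmonom G}) : bideg := \sum_(g <- (w : seq G)) deg g.

Lemma wdegM w w' : wdeg (mmul w w') = wdeg w + wdeg w'.
Proof. by rewrite /wdeg fmM big_cat. Qed.
Lemma wdeg1 : wdeg mone = 0. Proof. by rewrite /wdeg fm1 big_nil. Qed.
Lemma wdegU g : wdeg (fmu g) = deg g.
Proof. by rewrite /wdeg fmU big_seq1. Qed.

Definition frproj (d : bideg) : fralg -> fralg :=
  linext (fun w => if wdeg w == d then << w >> else 0).

Definition frhomog (d : bideg) (x : fralg) := frproj d x = x.

Lemma frproj_linear d : linear (frproj d). Proof. exact: linext_linear. Qed.

Lemma frprojU d w : frproj d << w >> = if wdeg w == d then << w >> else 0.
Proof. exact: linextU. Qed.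

Lemma frprojK d e x : frproj d (frproj e x) = if d == e then frproj e x else 0.
Proof.
move: x; apply: malg_lin_eq.
- exact: lin_comp (frproj_linear e) (frproj_linear d).
- by case: eqP => _; [exact: frproj_linear | exact: lin_zero].
move=> w; rewrite !frprojU; case: (eqVneq (wdeg w) e) => [<-|_].
  by rewrite frprojU eq_sym.
by rewrite (lin0 (frproj_linear d)) if_same.
Qed.

Lemma frproj_word d w w' x :
  frproj d (<< w >> * x * << w' >>) =
  << w >> * frproj (d - wdeg w - wdeg w') x * << w' >>.
Proof.
move: x; apply: malg_lin_eq.
- apply: lin_comp (frproj_linear d).
  exact: lin_comp (frmull_linear _) (frmulr_linear _).
- apply: lin_comp (frmulr_linear _).
  exact: lin_comp (frproj_linear _) (frmull_linear _).
move=> v; rewrite !malgUM !frprojU !wdegM.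
have -> : (wdeg w + wdeg v + wdeg w' == d) = (wdeg v == d - wdeg w - wdeg w').
  by rewrite [RHS]eq_sym !subr_eq eq_sym addrAC [wdeg w + _]addrC addrC addrA.
by case: eqP => _; rewrite ?malgUM // mulr0 mul0r.
Qed.

Lemma frhomog_lin d c x y :
  frhomog d x -> frhomog d y -> frhomog d (c *: x + y).
Proof. by rewrite /frhomog frproj_linear => -> ->. Qed.
Lemma frhomog0 d : frhomog d 0. Proof. exact: lin0 (frproj_linear d). Qed.
Lemma frhomogD d x y : frhomog d x -> frhomog d y -> frhomog d (x + y).
Proof. by move=> hx; rewrite -[x]scale1r; apply: frhomog_lin. Qed.
Lemma frhomogZ d c x : frhomog d x -> frhomog d (c *: x).
Proof. by move=> hx; rewrite -[_ *: _]addr0; apply: frhomog_lin (frhomog0 d). Qed.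
Lemma frhomogB d x y : frhomog d x -> frhomog d y -> frhomog d (x - y).
Proof. by move=> hx hy; rewrite -scaleN1r; apply/frhomogD/frhomogZ. Qed.
Lemma frhomog_sum d (I : Type) (r : seq I) (f : I -> fralg) :
  (forall i, frhomog d (f i)) -> frhomog d (\sum_(i <- r) f i).
Proof.
move=> fh; elim/big_rec: _ => [|i x _ hx]; first exact: frhomog0.
exact: frhomogD.
Qed.
Lemma frhomogU w : frhomog (wdeg w) << w >>.
Proof. by rewrite /frhomog frprojU eqxx. Qed.
Lemma frhomog1 : frhomog 0 1.
Proof. by rewrite -wdeg1; apply: frhomogU. Qed.

Lemma frprojM d e x y : frproj (d + e) (frproj d x * frproj e y) =
  frproj d x * frproj e y.
Proof.
move: x; apply: (@malg_lin_eq _ _ _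
  (fun x => frproj (d + e) (frproj d x * frproj e y))
  (fun x => frproj d x * frproj e y)).
- apply: lin_comp (frproj_linear _).
  exact: lin_comp (frproj_linear _) (frmulr_linear _).
- exact: lin_comp (frproj_linear _) (frmulr_linear _).
move=> w; rewrite frprojU; case: eqP => [<-|_]; last first.
  by rewrite !mul0r (lin0 (frproj_linear _)).
move: y; apply: (@malg_lin_eq _ _ _
  (fun y => frproj (wdeg w + e) (<< w >> * frproj e y))
  (fun y => << w >> * frproj e y)).
- apply: lin_comp (frproj_linear _).
  exact: lin_comp (frproj_linear _) (frmull_linear _).
- exact: lin_comp (frproj_linear _) (frmull_linear _).
move=> v; rewrite frprojU; case: eqP => [<-|_]; last first.
  by rewrite !mulr0 (lin0 (frproj_linear _)).
by rewrite malgUM -wdegM; apply: frhomogU.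
Qed.

Lemma frhomogM d e x y : frhomog d x -> frhomog e y -> frhomog (d + e) (x * y).
Proof. by move=> <- <-; apply: frprojM. Qed.
End FreeAlgebra.

(* ------------------------------------------------------------------ *)
(* Generators with their bidegrees, and bihomogeneous relations without
   constant term; the latter makes the presented algebra nonzero. *)
Record presentation (F : fieldType) := Presentation {
  pgen : choiceType;
  pdeg : pgen -> bideg;
  prel : {malg F[{fmonom pgen}]} -> Prop;
  prel_homog : forall x, prel x -> exists d, frhomog pdeg d x;
  prel_aug : forall x, prel x -> x@_mone = 0
}.

Section PresentedAlgebra.
Variables (F : fieldType) (P : presentation F).
Notation fralg := {malg F[{fmonom (pgen P)}]}.
Implicit Types x y z : fralg.

Definition ideal_gen z := exists u x v, prel x /\ z = u * x * v.

(* The free associative unital algebra modulo the two-sided ideal generated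
   by the relations. *)
Definition palg : Type := quotl ideal_gen.
HB.instance Definition _ := GRing.Lmodule.on palg.

Notation pi := (qpi ideal_gen).
Let piL := qpi_linear ideal_gen.

Lemma ideal_mull u x : span ideal_gen x -> span ideal_gen (u * x).
Proof.
elim=> {x} [|x [v [r [w [Pr ->]]]]|x y _ hx _ hy|c x _ hx].
- by rewrite mulr0; apply: span0.
- apply: span_gen; exists (u * v), r, w; split; first exact: Pr.
  rewrite (mulrA u) (mulrA u); reflexivity.
- by rewrite mulrDr; apply: spanD.
- by rewrite -frscalerAr; apply: spanZ.
Qed.

Lemma ideal_mulr u x : span ideal_gen x -> span ideal_gen (x * u).
Proof.
elim=> {x} [|x [v [r [w [Pr ->]]]]|x y _ hx _ hy|c x _ hx].
- by rewrite mul0r; apply: span0.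
- apply: span_gen; exists v, r, (w * u); split; first exact: Pr.
  exact/esym/mulrA.
- by rewrite mulrDl; apply: spanD.
- by rewrite -scalerAl; apply: spanZ.
Qed.

Definition pmul (p q : palg) : palg := pi (qrepr p * qrepr q).
Definition pone : palg := pi 1.

Lemma pmulE x y : pmul (pi x) (pi y) = pi (x * y).
Proof.
apply/qpi_eq; set x' := qrepr _; set y' := qrepr _.
have -> : x' * y' - x * y = (x' - x) * y' + x * (y' - y).
  by rewrite mulrBl mulrBr addrA subrK.
by apply: spanD; [apply: ideal_mulr | apply: ideal_mull];
  apply/qpi_eq; rewrite qreprK.
Qed.

Fact pmulA : associative pmul.
Proof.
move=> p q r; rewrite -[p]qreprK -[q]qreprK -[r]qreprK.
by rewrite !pmulE mulrA.
Qed.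
Fact pmul1l : left_id pone pmul.
Proof. by move=> p; rewrite -[p]qreprK pmulE mul1r. Qed.
Fact pmul1r : right_id pone pmul.
Proof. by move=> p; rewrite -[p]qreprK pmulE mulr1. Qed.
Fact pmulDl : left_distributive pmul +%R.
Proof.
move=> p q r; rewrite -[p]qreprK -[q]qreprK -[r]qreprK -(linD piL).
by rewrite !pmulE mulrDl (linD piL).
Qed.
Fact pmulDr : right_distributive pmul +%R.
Proof.
move=> p q r; rewrite -[p]qreprK -[q]qreprK -[r]qreprK -(linD piL).
by rewrite !pmulE mulrDr (linD piL).
Qed.
Fact pone_neq0 : pone != 0.
Proof.
apply/eqP; rewrite -(lin0 piL) => /qpi_eq; rewrite subr0.
suff aug x : span ideal_gen x -> x@_mone = 0.
  by move/aug/eqP; rewrite rmorph1 oner_eq0.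
elim=> [|_ [v [r [w [/prel_aug Pr ->]]]]|y z _ hy _ hz|c y _ hy].
- exact: mcoeff0.
- by rewrite !rmorphM /= Pr mulr0 mul0r.
- by rewrite mcoeffD hy hz addr0.
- by rewrite mcoeffZ hy mulr0.
Qed.
HB.instance Definition _ :=
  GRing.Zmodule_isNzRing.Build palg pmulA pmul1l pmul1r pmulDl pmulDr pone_neq0.

Lemma qpiM x y : pi (x * y) = (pi x : palg) * pi y.
Proof. by rewrite -[RHS]/(pmul _ _) pmulE. Qed.
Lemma qpi1 : pi 1 = 1 :> palg. Proof. by []. Qed.

Fact pscalerAl (c : F) (p q : palg) : c *: (p * q) = (c *: p) * q.
Proof.
by rewrite -[p]qreprK -[q]qreprK -qpiM -!(linZ piL) -qpiM scalerAl.
Qed.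
HB.instance Definition _ := GRing.Lmodule_isLalgebra.Build F palg pscalerAl.
Fact pscalerAr (c : F) (p q : palg) : c *: (p * q) = p * (c *: q).
Proof.
by rewrite -[p]qreprK -[q]qreprK -qpiM -!(linZ piL) -qpiM frscalerAr.
Qed.
HB.instance Definition _ := GRing.Lalgebra_isAlgebra.Build F palg pscalerAr.

Definition pproj (d : bideg) : palg -> palg :=
  @qlift _ _ ideal_gen _ (fun x => pi (frproj (@pdeg _ P) d x)).

Let fL d : linear (fun x => pi (frproj (@pdeg _ P) d x)).
Proof. exact: lin_comp (frproj_linear _ d) piL. Qed.

Lemma pproj_rel d x : ideal_gen x -> pi (frproj (@pdeg _ P) d x) = 0.
Proof.
move=> [u [r [v [Pr ->]]]]; apply: qpi0.
have [e er] := prel_homog Pr.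
have L : linear (@frproj F _ (@pdeg _ P) d) := frproj_linear _ d.
move: u; apply: malg_ind => [|u u' hu hu'|c w].
- by rewrite (lin0 (frmulr_linear _)) (lin0 (frmulr_linear _)) (lin0 L); apply: span0.
- rewrite (linD (frmulr_linear _)) (linD (frmulr_linear _)) (linD L).
  exact: spanD hu hu'.
rewrite (linZ (frmulr_linear _)) (linZ (frmulr_linear _)) (linZ L).
apply: spanZ; move: v; apply: malg_ind => [|v v' hv hv'|c' w'].
- by rewrite (lin0 (frmull_linear _)) (lin0 L); apply: span0.
- by rewrite (linD (frmull_linear _)) (linD L); apply: spanD hv hv'.
rewrite (linZ (frmull_linear _)) (linZ L) frproj_word.
apply: spanZ; apply: ideal_mulr; apply: ideal_mull.
rewrite -er frprojK; case: eqP => _; last exact: span0.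
by rewrite er; apply: span_gen; exists 1, r, 1; rewrite mul1r mulr1.
Qed.

Lemma pprojE d x : pproj d (pi x) = pi (frproj (@pdeg _ P) d x).
Proof. exact: qliftE (fL d) (@pproj_rel d) x. Qed.

Fact pproj_linear d : linear (pproj d).
Proof. exact: qlift_linear (fL d) (@pproj_rel d). Qed.
Fact pprojK d e p : pproj d (pproj e p) = if d == e then pproj e p else 0.
Proof.
rewrite -[p]qreprK !pprojE frprojK; case: eqP => // _; exact: lin0 piL.
Qed.
Fact pproj_fin p : exists s : seq bideg, uniq s && (p == \sum_(d <- s) pproj d p).
Proof.
change (fin_supp pproj p); rewrite -[p]qreprK; move: (qrepr p).
apply: malg_ind => [|x y hx hy|c w].
- by have -> : pi 0 = 0 := lin0 piL; exact: fin_supp0.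
- by have -> := linD piL x y; exact: fin_suppD pproj_linear pprojK _ _ hx hy.
apply: (@fin_suppH _ _ pproj (wdeg (@pdeg _ P) w)).
rewrite [LHS]pprojE; congr (pi _); exact/frhomogZ/frhomogU.
Qed.
Fact pproj1 : pproj 0 1 = 1.
Proof. by rewrite -qpi1 pprojE frhomog1. Qed.
Fact pprojM d e (p q : palg) :
  pproj (d + e) (pproj d p * pproj e q) = pproj d p * pproj e q.
Proof.
by rewrite -[p]qreprK -[q]qreprK (pprojE d) (pprojE e) -qpiM pprojE frprojM.
Qed.
HB.instance Definition _ := isBigraded.Build F palg
  pproj_linear pprojK pproj_fin pproj1 pprojM.

Definition pvar (g : pgen P) : palg := pi << fmu g >>.

Lemma qpi_homog d x : frhomog (@pdeg _ P) d x -> homog d (pi x : palg).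
Proof. by move=> dx; rewrite /homog [LHS]pprojE dx. Qed.

Lemma qpi_rel x : prel x -> pi x = 0.
Proof.
by move=> Px; apply/qpi0/span_gen; exists 1, x, 1; rewrite mul1r mulr1.
Qed.

Section Universal.
Variables (B : algType F) (f : pgen P -> B).

Definition freval : fralg -> B :=
  linext (fun w : {fmonom (pgen P)} => \prod_(g <- w) f g).

(* The algebra morphism sending each generator [g] to [f g]; only meaningful
   when [f] respects the relations. *)
Definition palg_lift : palg -> B := @qlift _ _ ideal_gen _ freval.

Lemma freval_linear : linear freval. Proof. exact: linext_linear. Qed.
Lemma frevalU (w : {fmonom (pgen P)}) : freval << w >> = \prod_(g <- w) f g.
Proof. exact: linextU. Qed.
Lemma freval1 : freval 1 = 1.
Proof. by rewrite -[1]/(<< mone >>) frevalU fm1 big_nil. Qed.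
Lemma frevalX g : freval << fmu g >> = f g.
Proof. by rewrite frevalU fmU big_seq1. Qed.
Lemma frevalM x y : freval (x * y) = freval x * freval y.
Proof.
have mL (z : B) : linear ( *%R z) by move=> c ? ?; rewrite mulrDr scalerAr.
have mR (z : B) : linear ( *%R^~ z) by move=> c ? ?; rewrite mulrDl scalerAl.
move: x; apply: malg_lin_eq.
- exact: lin_comp (frmulr_linear y) freval_linear.
- exact: lin_comp freval_linear (mR _).
move=> w; move: y; apply: malg_lin_eq.
- exact: lin_comp (frmull_linear _) freval_linear.
- exact: lin_comp freval_linear (mL _).
by move=> v; rewrite malgUM !frevalU fmM big_cat.
Qed.

Hypothesis fP : forall x, prel x -> freval x = 0.

Lemma freval_rel x : ideal_gen x -> freval x = 0.
Proof. by move=> [u [r [v [/fP r0 ->]]]]; rewrite !frevalM r0 mulr0 mul0r. Qed.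

Lemma palg_liftE x : palg_lift (pi x) = freval x.
Proof. exact: qliftE freval_linear freval_rel x. Qed.
Lemma palg_lift_linear : linear palg_lift.
Proof. exact: qlift_linear freval_linear freval_rel. Qed.
Lemma palg_lift1 : palg_lift 1 = 1.
Proof. by rewrite -qpi1 palg_liftE freval1. Qed.
Lemma palg_liftM : {morph palg_lift : p q / p * q}.
Proof.
move=> p q; rewrite -[p]qreprK -[q]qreprK -qpiM !palg_liftE; exact: frevalM.
Qed.
Lemma palg_lift_var g : palg_lift (pvar g) = f g.
Proof. by rewrite palg_liftE frevalX. Qed.
End Universal.
End PresentedAlgebra.

Section AlgebraMorphisms.
Variable F : fieldType.

Definition algmorph (A B : algType F) (f : A -> B) : Prop :=
  [/\ linear f, f 1 = 1 & {morph f : x y / x * y}].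

Definition bgmorph (A B : bgAlgType F) (f : A -> B) : Prop :=
  algmorph f /\ (forall d x, homog d x -> homog d (f x)).

Section TensorMaps.
Variables A B C A' B' : bgAlgType F.

(* [tmap f g] is meaningful for linear [f] and [g] of bidegree (0, 0), so that no
   Koszul sign occurs. *)
Definition tmap (f : A -> A') (g : B -> B') : A ⊗ B -> A' ⊗ B' :=
  tlift (fun x y => f x ⊗ g y).

Definition tassoc : (A ⊗ B) ⊗ C -> A ⊗ (B ⊗ C) :=
  tlift (fun t z => tlift (fun x y => x ⊗ (y ⊗ z)) t).

(* x ⊗ y |-> (-1)^(|x||y|) y ⊗ x *)
Definition tswap : A ⊗ B -> B ⊗ A :=
  tlift (wsum (@ksign F) (fun x y => y ⊗ x)).
End TensorMaps.

Lemma algmorph_id (A : algType F) : algmorph (@id A). Proof. by []. Qed.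

Variable P : presentation F.

Lemma palg_ext (B : algType F) (f g : palg P -> B) :
  algmorph f -> algmorph g -> (forall v, f (pvar v) = g (pvar v)) -> f =1 g.
Proof.
move=> [fL f1 fM] [gL g1 gM] fg p; rewrite -[p]qreprK; move: (qrepr p).
have qL := qpi_linear (@ideal_gen _ P).
apply: malg_lin_eq; [exact: lin_comp qL fL | exact: lin_comp qL gL | case].
elim=> [|v s IH]; first by rewrite -fmoneE -[<< _ >>]/(1 : {malg F[_]}) qpi1 f1 g1.
have -> : FMonom (v :: s) = mmul (fmu v) (FMonom s).
  by rewrite [mmul _ _]fmmulE fmuE.
rewrite -malgUM qpiM fM gM IH; congr (_ * _); exact: fg.
Qed.

Section Lift.
Variables (B : bgAlgType F) (f : pgen P -> B).
Hypothesis fP : forall x, prel x -> freval f x = 0.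

Lemma palg_lift_algmorph : algmorph (palg_lift f).
Proof.
by split; [exact: palg_lift_linear | exact: palg_lift1 | exact: palg_liftM].
Qed.

Lemma palg_lift_homog : (forall v, homog (pdeg v) (f v)) ->
  forall d x, homog d x -> homog d (palg_lift f x).
Proof.
move=> fh d x <-; rewrite -[x]qreprK [gproj _ _]pprojE (palg_liftE fP).
have FL := freval_linear f; move: (qrepr x); have pL := @frproj_linear F _ (@pdeg _ P) d.
apply: malg_ind => [|y z hy hz|c w].
- by rewrite (lin0 pL) (lin0 FL); exact: homog0.
- by rewrite (linD pL) (linD FL); exact: homogD.
rewrite (linZ pL) (linZ FL); apply: homogZ.
rewrite frprojU; case: eqP => [<-|_]; last by rewrite (lin0 FL); exact: homog0.
rewrite frevalU /wdeg; elim: (w : seq _) => [|v s IH].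
  by rewrite !big_nil; exact: homog1.
by rewrite !big_cons; exact: homogM.
Qed.
End Lift.
End AlgebraMorphisms.

(* ------------------------------------------------------------------ *)
Section RPresentation.
Variables (F : fieldType) (I : finType).

(* [(false, (i, j))] stands for $a_{i,j}$ and [(true, (i, j))] for $b_{i,j}$. *)
Definition Rgen : choiceType := (bool * {p : I * I | p.1 != p.2})%type.
Definition Rdeg (g : Rgen) : bideg := (Posz g.1, 1).

Notation fralg := {malg F[{fmonom Rgen}]}.

(* Set to 0 when [i = j], a case that no relation uses. *)
Definition frgen (c : bool) (i j : I) : fralg :=
  if insub (i, j) is Some p then << fmu ((c, p) : Rgen) >> else 0.

Notation a := (frgen false).
Notation b := (frgen true).

(* $b_{i,s_1} b_{s_1,s_2} \cdots$ *)
Fixpoint bpath (i : I) (s : seq I) : fralg :=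
  if s is j :: s' then b i j * bpath j s' else 1.

(* Representatives of the orderings of i, j, k, l up to reversal. *)
Definition words12 (i j k l : I) : seq (I * I * I * I) :=
  [:: (i, j, k, l); (i, k, j, l); (i, j, l, k); (i, l, j, k);
      (i, k, l, j); (i, l, k, j); (j, i, k, l); (j, k, i, l);
      (j, i, l, k); (j, l, i, k); (k, i, j, l); (k, j, i, l)].

(* [Rcomm] imposes graded commutativity, the Koszul sign [ksign] depending on the
   first degrees only. *)
Inductive Rrel : fralg -> Prop :=
| Rcomm (g h : Rgen) :
    Rrel (<< fmu g >> * << fmu h >>
          - ksign F (Rdeg g) (Rdeg h) *: (<< fmu h >> * << fmu g >>))
| Ranti c i j of i != j : Rrel (frgen c i j + frgen c j i)
| Rsquare i j of i != j : Rrel (a i j * a i j)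
| Raa i j k of uniq [:: i; j; k] :
    Rrel (a i j * a j k + a j k * a k i + a k i * a i j)
| Rba i j k of uniq [:: i; j; k] :
    Rrel (b i j * a j k + b j k * a k i + b k i * a i j
          + a i j * b j k + a j k * b k i + a k i * b i j)
| Rcycle_ab i j s of uniq [:: i, j & s] : Rrel (a i j * bpath j (rcons s i))
| Rcycle_b i j s of uniq [:: i, j & s] : Rrel (b i j * bpath j (rcons s i))
| Rbab i j k l of uniq [:: i; j; k; l] :
    Rrel (\sum_(w <- words12 i j k l)
            let: (w1, w2, w3, w4) := w in b w1 w2 * a w2 w3 * b w3 w4)
| Rbbb i j k l of uniq [:: i; j; k; l] :
    Rrel (\sum_(w <- words12 i j k l)
            let: (w1, w2, w3, w4) := w in b w1 w2 * b w2 w3 * b w3 w4).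

Notation homog := (frhomog Rdeg).
Notation D c := ((Posz (c : bool), Posz 1) : bideg).

Lemma frgen_homog c i j : homog (D c) (frgen c i j).
Proof.
rewrite /frgen; case: insubP => [p _ _|_]; last exact: frhomog0.
have := @frhomogU F _ Rdeg (fmu ((c, p) : Rgen)).
by rewrite (wdegU Rdeg (c, p)).
Qed.

Lemma bpath_homog i s : exists d, homog d (bpath i s).
Proof.
elim: s i => [|j s IH] i /=; first by exists 0; apply: frhomog1.
have [d hd] := IH j; exists (D true + d).
exact: frhomogM (frgen_homog _ _ _) hd.
Qed.

Lemma Rrel_homog x : Rrel x -> exists d, homog d x.
Proof.
have gM c c' i j k l : homog (D c + D c') (frgen c i j * frgen c' k l).
  exact: frhomogM (frgen_homog _ _ _) (frgen_homog _ _ _).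
have gMc c c' i j k l : homog (D c + D c') (frgen c' i j * frgen c k l).
  by rewrite addrC.
case=> {x} [g h|c i j _|i j _|i j k _|i j k _|i j s _|i j s _|i j k l _|i j k l _].
- have gh (u v : Rgen) : homog (Rdeg u + Rdeg v) (<< fmu u >> * << fmu v >> : fralg).
    rewrite -(wdegU Rdeg u) -(wdegU Rdeg v).
    exact: frhomogM (frhomogU _ _ _) (frhomogU _ _ _).
  exists (Rdeg g + Rdeg h); apply: (frhomogB (gh g h)); apply: frhomogZ.
  by rewrite addrC; exact: gh.
- by exists (D c); apply: frhomogD; apply: frgen_homog.
- by eexists; apply: gM.
- by exists (D false + D false); do 2?apply: frhomogD; apply: gM.
- exists (D true + D false).
  by do 5?apply: frhomogD; [apply: gM..|apply: gMc|apply: gMc|apply: gMc].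
- have [d hd] := bpath_homog j (rcons s i); exists (D false + d).
  exact: frhomogM (frgen_homog _ _ _) hd.
- have [d hd] := bpath_homog j (rcons s i); exists (D true + d).
  exact: frhomogM (frgen_homog _ _ _) hd.
- exists (D true + D false + D true); apply: frhomog_sum => -[[[p q] r] s].
  exact: frhomogM (gM _ _ _ _ _ _) (frgen_homog _ _ _).
- exists (D true + D true + D true); apply: frhomog_sum => -[[[p q] r] s].
  exact: frhomogM (gM _ _ _ _ _ _) (frgen_homog _ _ _).
Qed.

Lemma Rrel_aug x : Rrel x -> x@_mone = 0.
Proof.
have U (g : Rgen) : (<< fmu g >> : fralg)@_mone = 0.
  by rewrite mcoeffU1 fm1_eq1.
have gen0 c i j : (frgen c i j)@_mone = 0.
  by rewrite /frgen; case: insubP => [p _ _|_]; [exact: U | exact: mcoeff0].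
have M0 (y z : fralg) : y@_mone = 0 -> (y * z)@_mone = 0.
  by move=> y0; rewrite rmorphM /= y0 mul0r.
have D0 (y z : fralg) : y@_mone = 0 -> z@_mone = 0 -> (y + z)@_mone = 0.
  by move=> y0 z0; rewrite mcoeffD y0 z0 addr0.
have gM c i j z : (frgen c i j * z)@_mone = 0 by apply: M0.
case=> {x} [g h|c i j _|i j _|i j k _|i j k _|i j s _|i j s _|i j k l _|i j k l _].
- apply: D0; first exact/M0/U.
  by rewrite mcoeffN mcoeffZ (M0 _ _ (U h)) mulr0 oppr0.
- by apply: D0; apply: gen0.
- exact: gM.
- exact: D0 _ _ (D0 _ _ (gM _ _ _ _) (gM _ _ _ _)) (gM _ _ _ _).
- exact: D0 _ _ (D0 _ _ (D0 _ _ (D0 _ _ (D0 _ _ (gM _ _ _ _) (gM _ _ _ _))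
    (gM _ _ _ _)) (gM _ _ _ _)) (gM _ _ _ _)) (gM _ _ _ _).
- exact: gM.
- exact: gM.
- rewrite raddf_sum big1 // => -[[[p q] r] s] _ /=.
  exact/M0/gM.
- rewrite raddf_sum big1 // => -[[[p q] r] s] _ /=.
  exact/M0/gM.
Qed.

Definition Rpres : presentation F :=
  @Presentation F Rgen Rdeg Rrel Rrel_homog Rrel_aug.

Definition Ralg : bgAlgType F := palg Rpres.

(* The class of $a_{i,j}$ ([c = false]) or $b_{i,j}$ ([c = true]), for [i != j]. *)
Definition Rvar (c : bool) (i j : I) : Ralg := qpi _ (frgen c i j).
End RPresentation.

Section Transfer.
Variables (F : fieldType) (I J : finType) (f : I -> J).
Hypothesis f_inj : injective f.
Notation frI := {malg F[{fmonom (Rgen I)}]}.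
Notation frJ := {malg F[{fmonom (Rgen J)}]}.
Variables (B : algType F) (ev : frI -> B) (pi : frJ -> B).
Hypotheses (evL : linear ev) (ev1 : ev 1 = 1) (evM : {morph ev : x y / x * y}).
Hypotheses (piL : linear pi) (pi1 : pi 1 = 1) (piM : {morph pi : x y / x * y}).
Hypothesis ev_gen :
  forall c i j, i != j -> ev (frgen F c i j) = pi (frgen F c (f i) (f j)).

Lemma ev_genM c i j x y : i != j -> ev x = pi y ->
  ev (frgen F c i j * x) = pi (frgen F c (f i) (f j) * y).
Proof. by move=> ij xy; rewrite evM piM ev_gen // xy. Qed.

Lemma ev_D x y x' y' : ev x = pi x' -> ev y = pi y' -> ev (x + y) = pi (x' + y').
Proof. by move=> xx yy; rewrite (linD evL) (linD piL) xx yy. Qed.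

Lemma ev_M x y x' y' : ev x = pi x' -> ev y = pi y' -> ev (x * y) = pi (x' * y').
Proof. by move=> xx yy; rewrite evM piM xx yy. Qed.

Lemma ev_bpath i s : path (fun x y => x != y) i s ->
  ev (bpath F i s) = pi (bpath F (f i) (map f s)).
Proof.
elim: s i => [|j s IH] i /=; first by rewrite ev1 pi1.
by case/andP => ij /IH js; apply: ev_genM.
Qed.

Lemma uniq_neq_path (i j : I) s : uniq [:: i, j & s] ->
  path (fun x y => x != y) j (rcons s i).
Proof.
rewrite cons_uniq => /andP[i_js js]; rewrite rcons_path; apply/andP; split.
  elim: s j {i_js} js => //= k s IH j /andP[j_ks ks].
  rewrite IH ?andbT //; first by apply: contraNneq j_ks => ->; rewrite inE eqxx.
by apply: contraNneq i_js => <-; apply: mem_last.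
Qed.

Lemma ev_sum12 (gI : I * I * I * I -> frI) (gJ : J * J * J * J -> frJ) i j k l :
  uniq [:: i; j; k; l] ->
  (forall w1 w2 w3 w4, uniq [:: w1; w2; w3; w4] ->
     ev (gI (w1, w2, w3, w4)) = pi (gJ (f w1, f w2, f w3, f w4))) ->
  ev (\sum_(w <- words12 i j k l) gI w) =
  pi (\sum_(w <- words12 (f i) (f j) (f k) (f l)) gJ w).
Proof.
move=> uijkl gE; rewrite (lin_sum evL) (lin_sum piL).
pose fw (w : I * I * I * I) := let: (w1, w2, w3, w4) := w in (f w1, f w2, f w3, f w4).
have -> : words12 (f i) (f j) (f k) (f l) = map fw (words12 i j k l) by [].
rewrite big_map; apply: eq_big_seq => -[[[w1 w2] w3] w4] ww; apply: gE.
suff /perm_uniq-> : perm_eq [:: w1; w2; w3; w4] [:: i; j; k; l] by [].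
move: ww; rewrite /words12 !inE.
by do 11?[case/orP]; move=> /eqP[-> -> -> ->]; apply/seq.permP => p /=; lia.
Qed.

Lemma Rrel_transfer x : Rrel x -> exists2 y : frJ, Rrel y & ev x = pi y.
Proof.
have funiq s : uniq s -> uniq (map f s) by rewrite (map_inj_uniq f_inj).
have fneq i j : i != j -> f i != f j by rewrite (inj_eq f_inj).
have gg c c' i j k l : i != j -> k != l -> ev (frgen F c i j * frgen F c' k l) =
    pi (frgen F c (f i) (f j) * frgen F c' (f k) (f l)).
  by move=> ij kl; apply: ev_genM => //; apply: ev_gen.
case=> {x} [g h|c i j ij|i j ij|i j k ijk|i j k ijk|i j s ijs|i j s ijs
           |i j k l ijkl|i j k l ijkl].
- have gX (v : Rgen I) : exists2 v' : Rgen J, v'.1 = v.1 &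
      ev << fmu v >> = pi << fmu v' >>.
    case: v => c [[p q] pq]; exists (c, exist _ (f p, f q) (fneq p q pq)) => //.
    have := ev_gen c pq; rewrite /frgen.
    by rewrite (@insubT _ (fun r => r.1 != r.2) _ (p, q) pq)
      (@insubT _ (fun r => r.1 != r.2) _ (f p, f q) (fneq p q pq)).
  have [g' g1 gE] := gX g; have [h' h1 hE] := gX h.
  eexists; first exact: (Rcomm F g' h').
  rewrite -!scaleNr; apply: ev_D; first exact: ev_M.
  rewrite (linZ evL) (linZ piL) /Rdeg g1 h1; congr (_ *: _); exact: ev_M.
- by eexists; [apply: (Ranti F c (fneq _ _ ij)) | apply: ev_D; apply: ev_gen; rewrite // eq_sym].
- by eexists; [apply: (Rsquare F (fneq _ _ ij)) | apply: ev_genM => //; apply: ev_gen].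
- eexists; first exact: (Raa F (funiq _ ijk)).
  have {ijk} /and3P[ij jk ki] : [&& i != j, j != k & k != i].
    by move: ijk; rewrite /= !inE !negb_or andbT => /andP[/andP[-> ik] ->]; rewrite eq_sym.
  by apply: ev_D; [apply: ev_D|]; apply: gg.
- eexists; first exact: (Rba F (funiq _ ijk)).
  have {ijk} /and3P[ij jk ki] : [&& i != j, j != k & k != i].
    by move: ijk; rewrite /= !inE !negb_or andbT => /andP[/andP[-> ik] ->]; rewrite eq_sym.
  by apply: ev_D; [do 4!(apply: ev_D; last by apply: gg)|]; apply: gg.
- eexists; first exact: (Rcycle_ab F (funiq _ ijs)).
  rewrite -map_rcons; apply: ev_genM.
    by move: ijs; rewrite /= inE negb_or -!andbA => /andP[].
  exact/ev_bpath/uniq_neq_path.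
- eexists; first exact: (Rcycle_b F (funiq _ ijs)).
  rewrite -map_rcons; apply: ev_genM.
    by move: ijs; rewrite /= inE negb_or -!andbA => /andP[].
  exact/ev_bpath/uniq_neq_path.
- eexists; first exact: (Rbab F (funiq _ ijkl)).
  apply: ev_sum12 => // p q r s.
  rewrite /= !inE !negb_or !andbT -!andbA => /and4P[pq _ _ /and3P[qr _ rs]].
  by apply: ev_M; [apply: ev_genM => //|]; apply: ev_gen.
- eexists; first exact: (Rbbb F (funiq _ ijkl)).
  apply: ev_sum12 => // p q r s.
  rewrite /= !inE !negb_or !andbT -!andbA => /and4P[pq _ _ /and3P[qr _ rs]].
  by apply: ev_M; [apply: ev_genM => //|]; apply: ev_gen.
Qed.
End Transfer.

Section Relabelling.
Variable F : fieldType.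
Notation R := (Ralg F).

Definition Rmap (I J : finType) (f : I -> J) : R I -> R J :=
  @palg_lift F (Rpres F I) (R J)
    (fun g : Rgen I => Rvar F g.1 (f (val g.2).1) (f (val g.2).2)).

Lemma RvarE (I : finType) (g : Rgen I) :
  Rvar F g.1 (val g.2).1 (val g.2).2 = @pvar F (Rpres F I) g.
Proof.
by case: g => c [[i j] ij]; rewrite /Rvar /frgen /= insubT.
Qed.

Lemma Rvar_homog (I : finType) c (i j : I) :
  homog ((Posz (c : bool), Posz 1) : bideg) (Rvar F c i j).
Proof. by apply: qpi_homog; apply: frgen_homog. Qed.


Lemma Rmap_rel (I J : finType) (f : I -> J) : injective f ->
  forall x, Rrel x -> @freval F (Rpres F I) (R J)
    (fun g : Rgen I => Rvar F g.1 (f (val g.2).1) (f (val g.2).2)) x = 0.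
Proof.
move=> f_inj x; set phi := (fun _ => _); set ev := (freval _) => Rx.
pose pi : {malg F[{fmonom (Rgen J)}]} -> R J := qpi (@ideal_gen F (Rpres F J)).
have [|y Ry ->] := @Rrel_transfer F I J f f_inj (R J) ev pi
  (@freval_linear F (Rpres F I) (R J) phi) (@freval1 F (Rpres F I) (R J) phi) (@frevalM F (Rpres F I) (R J) phi)
  (qpi_linear _) (qpi1 (Rpres F J)) (@qpiM F (Rpres F J)) _ x Rx.
  move=> c i j ij; rewrite /ev {1}/frgen insubT.
  exact: (@frevalX F (Rpres F I) (R J) phi).
exact: (@qpi_rel F (Rpres F J)).
Qed.

Lemma Rmap_bgmorph (I J : finType) (f : I -> J) : injective f -> bgmorph (@Rmap I J f).
Proof.
move=> /Rmap_rel fP; split; first exact: (@palg_lift_algmorph F (Rpres F I) (R J) _ fP).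
apply: (@palg_lift_homog F (Rpres F I) (R J) _ fP) => -[c [[i j] ij]]; exact: Rvar_homog.
Qed.

Lemma Rmap_var (I J : finType) (f : I -> J) c i j : injective f -> i != j ->
  Rmap f (Rvar F c i j) = Rvar F c (f i) (f j).
Proof.
move=> /Rmap_rel fP ij.
have -> : Rvar F c i j = @pvar F (Rpres F I) (c, exist _ (i, j) ij).
  by rewrite -RvarE.
exact: (@palg_lift_var F (Rpres F I) (R J) _ fP (c, exist _ (i, j) ij)).
Qed.

Lemma Rmap_id (I : finType) : @Rmap I I id =1 id.
Proof.
apply: (@palg_ext F (Rpres F I)); [exact: (Rmap_bgmorph (@inj_id I)).1 | exact: algmorph_id |].
by move=> [c [[i j] ij]]; rewrite -RvarE /= Rmap_var.
Qed.

Lemma algmorph_comp (A B C : algType F) (g : B -> C) (f : A -> B) :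
  algmorph f -> algmorph g -> algmorph (fun x => g (f x)).
Proof.
move=> [fL f1 fM] [gL g1 gM]; split; first exact: lin_comp.
  by rewrite f1.
by move=> x y; rewrite fM gM.
Qed.

Lemma Rmap_comp (I J K : finType) (f : I -> J) (g : J -> K) :
  injective f -> injective g ->
  Rmap (fun i => g (f i)) =1 (fun x => Rmap g (Rmap f x)).
Proof.
move=> fi gi; apply: (@palg_ext F (Rpres F I)).
- exact: (Rmap_bgmorph (inj_comp gi fi)).1.
- exact: algmorph_comp (Rmap_bgmorph fi).1 (Rmap_bgmorph gi).1.
move=> [c [[i j] ij]]; rewrite -RvarE /= (@Rmap_var I K (fun i => g (f i))) //.
  by rewrite !Rmap_var // (inj_eq fi).
exact: inj_comp gi fi.
Qed.
End Relabelling.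

(* ------------------------------------------------------------------ *)
(* Functors from finite sets and bijections to bigraded algebras; the value of
   [relabel] at maps that are not bijective is irrelevant. *)
Record algSpecies (F : fieldType) := AlgSpecies {
  sp_obj :> finType -> bgAlgType F;
  relabel : forall I J : finType, (I -> J) -> sp_obj I -> sp_obj J;
  relabel_morph : forall (I J : finType) (f : I -> J),
    bijective f -> bgmorph (@relabel I J f);
  relabel_id : forall I : finType, @relabel I I id =1 id;
  relabel_comp : forall (I J K : finType) (f : I -> J) (g : J -> K),
    bijective f -> bijective g -> relabel (g \o f) =1 relabel g \o relabel f
}.
Arguments relabel {F} a {I J} f x.

Definition Rspecies (F : fieldType) : algSpecies F :=
  @AlgSpecies F (Ralg F) (@Rmap F)
    (fun I J f fb => Rmap_bgmorph F (bij_inj fb)) (@Rmap_id F)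
    (fun I J K f g fb gb => Rmap_comp (bij_inj fb) (bij_inj gb)).

(* I ⊔ J is [I + J], and I ⊔ {★} (or I ⊔ {#}) is [option I], with [None] as the
   added point. The maps below are the canonical bijections needed to compose
   partial decompositions:
     sumA  : (I ⊔ J) ⊔ K -> I ⊔ (J ⊔ K)     optA  : (I ⊔ J) ⊔ {#} -> I ⊔ (J ⊔ {#})
     sumAC : (I ⊔ J) ⊔ K -> (I ⊔ K) ⊔ J     optAC : (I ⊔ J) ⊔ {#} -> (I ⊔ {#}) ⊔ J
     optC  : (I ⊔ {★}) ⊔ {#} -> (I ⊔ {#}) ⊔ {★} *)
Section Bijections.
Variables I J K I' J' : Type.

Definition sum_map (f : I -> I') (g : J -> J') (x : I + J) : I' + J' :=
  match x with inl i => inl (f i) | inr j => inr (g j) end.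

Definition sumA (x : I + J + K) : I + (J + K) :=
  match x with
  | inl (inl i) => inl i
  | inl (inr j) => inr (inl j)
  | inr k => inr (inr k)
  end.

Definition sumAC (x : I + J + K) : I + K + J :=
  match x with
  | inl (inl i) => inl (inl i)
  | inl (inr j) => inr j
  | inr k => inl (inr k)
  end.

Definition optA (x : option (I + J)) : I + option J :=
  match x with
  | Some (inl i) => inl i
  | Some (inr j) => inr (Some j)
  | None => inr None
  end.

Definition optAC (x : option (I + J)) : option I + J :=
  match x with
  | Some (inl i) => inl (Some i)
  | Some (inr j) => inr j
  | None => inl None
  end.

Definition optC (x : option (option I)) : option (option I) :=
  match x with
  | Some (Some i) => Some (Some i)
  | Some None => None
  | None => Some None
  end.
End Bijections.

Section Cooperad.
Variables (F : fieldType) (P : algSpecies F).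
Variable Theta : forall I J : finType, P (I + J)%type -> P (option I) ⊗ P J.

Record cooperad_structure : Prop := CooperadStructure {
  cooperad_morph : forall I J : finType, bgmorph (@Theta I J);
  cooperad_natural : forall (I I' J J' : finType) (f : I -> I') (g : J -> J'),
    bijective f -> bijective g -> forall x : P (I + J)%type,
    Theta (relabel P (sum_map f g) x) =
    tmap (relabel P (omap f)) (relabel P g) (Theta x);
  cooperad_seq : forall (I J K : finType) (x : P (I + J + K)%type),
    tassoc (tmap (fun y => Theta (relabel P (@optA I J) y)) id (Theta x)) =
    tmap id (@Theta J K) (Theta (relabel P (@sumA I J K) x));
  (* In [option (option I)], the outer point is ★ on the left-hand side and #
     on the right-hand side before [optC]. *)
  cooperad_par : forall (I J K : finType) (x : P (I + J + K)%type),
    tassoc (tmap (fun y => Theta (relabel P (@optAC I J) y)) id (Theta x)) =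
    tmap (relabel P (@optC I)) (@tswap F (P K) (P J))
      (tassoc (tmap (fun y => Theta (relabel P (@optAC I K) y)) id
        (Theta (relabel P (@sumAC I J K) x))))
}.
End Cooperad.

(* The algebra morphism Θ^★_{I,J}, specified on generators. *)
Definition is_Theta (F : fieldType) (I J : finType)
    (theta : Ralg F (I + J)%type -> Ralg F (option I) ⊗ Ralg F J) : Prop :=
  algmorph theta /\
  forall c : bool,
  [/\ forall i i' : I, i != i' ->
        theta (Rvar F c (inl i) (inl i')) = Rvar F c (Some i) (Some i') ⊗ 1,
      forall j j' : J, j != j' ->
        theta (Rvar F c (inr j) (inr j')) = 1 ⊗ Rvar F c j j' &
      forall (i : I) (j : J),
        theta (Rvar F c (inl i) (inr j)) = Rvar F c (Some i) None ⊗ 1].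

(* Main.v *)
Require Import Defs.
From mathcomp Require Import all_boot all_algebra reals complex.
From mathcomp Require Import monalg zify.

(** Since R(X) is presented by generators and relations, everything reduces to
    computations with generators once the map Theta is known to exist. It exists
    when the images of the generators of R(I + J) satisfy the relations of
    R(I + J). These images arise from the generators of R(option I) and of R(J),
    seen in the tensor product, by collapsing J onto the added point: the
    generators c_{i,i'} with both indices in J go to the second factor, the other
    ones to the first factor with every index of J replaced by the added point.

    The verification uses nothing of the tensor product except that the two
    factors commute up to the Koszul sign. It is therefore carried out for two
    families u (indexed by option I) and w (indexed by J) of elements of one
    algebra, each satisfying the relations ([Rfamily]), and the conclusion is
    that the glued family satisfies them too ([Rfamily_glue]). A relation whose
    indices contain at most one point of J is a relation for u, and one whose
    indices all lie in J is a relation for w. The mixed ones hold as follows.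
    - A product over a closed walk through both I and J contains an arc that
      leaves J, stays in I and comes back to J. After collapsing, this arc is a
      closed walk with distinct vertices and at most one factor a, so its product
      is zero by the cycle relations for u ([cycle_eq0], [glue_cycle]).
    - In the relations with three or four indices, the terms in which one or two
      points of I sit between two points of J contain a closed walk at the added
      point p and vanish; when there is only one point i of I, this says that
      c_{i,p} d_{i,p} = 0 for all c, d among a and b ([glue_backtrack]). The other
      terms cancel by antisymmetry and commutation, except that the 12-term
      relations with three indices in J leave a multiple of the 6-term relation
      for w, or pairs of opposite products of two b ([glue_bcb_LRRR]).

    Naturality and the two coassociativity identities equate two algebra
    morphisms out of a presented algebra, because the tensor product of two
    morphisms, the associativity isomorphism and the Koszul symmetry are all
    algebra morphisms. Such an identity is checked on generators, according to
    the blocks containing the two indices. *)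

Set Implicit Arguments.
Unset Strict Implicit.
Unset Printing Implicit Defensive.

Import GRing.Theory.
Local Open Scope ring_scope.

(** * Products along walks in a quasi-commutative family *)

Section Walks.
Variables (F : fieldType) (B : algType F).

(** Koszul signs are irrelevant for the vanishing of a product, so commutation up
    to an arbitrary scalar is what the cyclic rotation of a closed walk needs. *)
Definition qcomm (x y : B) := exists k : F, x * y = k *: (y * x).

Lemma qcommM x y z : qcomm x y -> qcomm x z -> qcomm x (y * z).
Proof.
move=> [k xy] [l xz]; exists (k * l).
by rewrite mulrA xy -scalerAl -(mulrA y x z) xz -scalerAr mulrA scalerA.
Qed.

Lemma qcommMl x y z : qcomm x z -> qcomm y z -> qcomm (x * y) z.
Proof.
move=> [k xz] [l yz]; exists (l * k).
by rewrite -mulrA yz -scalerAr (mulrA x z y) xz -scalerAl -mulrA scalerA.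
Qed.

Lemma qcomm1 x : qcomm x 1.
Proof. by exists 1; rewrite mulr1 mul1r scale1r. Qed.

Lemma qcomm1l x : qcomm 1 x.
Proof. by exists 1; rewrite mulr1 mul1r scale1r. Qed.

Variables (X : Type) (v : bool -> X -> X -> B).

(** An entry (c, y) of [s] is an edge of colour [c] ending at [y], so the vertices
    of a closed walk, each counted once, are [unzip2 s]. *)
Fixpoint walk (x : X) (s : seq (bool * X)) : B :=
  if s is (c, y) :: s' then v c x y * walk y s' else 1.

Lemma walk_cat x s t :
  walk x (s ++ t) = walk x s * walk (last x (unzip2 s)) t.
Proof. by elim: s x => [|[c y] s IH] x /=; rewrite ?mul1r // IH mulrA. Qed.

Hypothesis vC : forall c x y d z t, qcomm (v c x y) (v d z t).

Lemma walk_qcomm x s y t : qcomm (walk x s) (walk y t).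
Proof.
elim: s x => [|[c x'] s IH] x /=; first exact: qcomm1l.
apply: qcommMl => {IH}//; elim: t y => [|[d y'] t IH] y /=; first exact: qcomm1.
exact: qcommM.
Qed.

(** The vanishing of the product along a closed walk does not depend on its
    starting point. *)
Lemma walk_rot x s t : last x (unzip2 (s ++ t)) = x ->
  exists k : F, walk x (s ++ t) = k *: walk (last x (unzip2 s)) (t ++ s).
Proof.
rewrite /unzip2 map_cat last_cat !walk_cat -!/(unzip2 _) => ->.
exact: walk_qcomm.
Qed.
End Walks.

(** * Symmetry of the 12-term sums *)

(** The 12 terms are explicit so that a transposition of letters becomes a
    rearrangement of summands. *)
Definition sum12 (V : nmodType) (X : Type) (h : X -> X -> X -> X -> V) x y z t : V :=
  h x y z t + h x z y t + h x y t z + h x t y z + h x z t y + h x t z y +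
  h y x z t + h y z x t + h y x t z + h y t x z + h z x y t + h z y x t.

Lemma sum12E (V : nmodType) (X : finType) (h : X -> X -> X -> X -> V) x y z t :
  \sum_(w <- words12 x y z t)
     (let: (w1, w2, w3, w4) := w in h w1 w2 w3 w4) = sum12 h x y z t.
Proof. by rewrite /words12 !big_cons big_nil addr0 !addrA. Qed.

Section Sum12Symmetry.
Variables (V : nmodType) (X : Type) (h : X -> X -> X -> X -> V).
(* The 12 words represent the orderings up to reversal; a summand invariant under
   reversal therefore gives a sum invariant under all permutations of the letters. *)
Hypothesis h_rev : forall x y z t, h t z y x = h x y z t.

Lemma sum12_swap12 x y z t : sum12 h y x z t = sum12 h x y z t.
Proof.
rewrite /sum12 -(h_rev y t z x) -(h_rev y z t x).
by rewrite [LHS](ACl (7*8*9*10*6*5*1*2*3*4*12*11))%AC.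
Qed.

Lemma sum12_swap23 x y z t : sum12 h x z y t = sum12 h x y z t.
Proof.
rewrite /sum12 -(h_rev z t x y) -(h_rev z x t y).
by rewrite [LHS](ACl (2*1*5*6*3*4*11*12*10*9*7*8))%AC.
Qed.

Lemma sum12_swap34 x y z t : sum12 h x y t z = sum12 h x y z t.
Proof.
rewrite /sum12 -(h_rev t y x z) -(h_rev t x y z).
by rewrite [LHS](ACl (3*4*1*2*6*5*9*10*7*8*12*11))%AC.
Qed.
End Sum12Symmetry.

(** * Families satisfying the relations *)

(** The Koszul sign between generators of colours [c] and [d]. *)
Definition signb (F : fieldType) (c d : bool) : F := (-1) ^+ (c && d).

(** The monomials of both 12-term relations: the middle letter is a or b. *)
Definition bcb (B : nzRingType) (X : Type) (v : bool -> X -> X -> B) c x y z t : B :=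
  v true x y * v c y z * v true z t.

(** A morphism of algebras from R(X) to [B] is the same as such a family
    ([Rlift_algmorph], [Rvar_family]); the value at a repeated index is set to 0,
    in accordance with antisymmetry. *)
Record Rfamily (F : fieldType) (B : algType F) (X : finType)
    (v : bool -> X -> X -> B) : Prop := RFamily {
  rf_diag : forall c x, v c x x = 0;
  rf_anti : forall c x y, v c y x = - v c x y;
  rf_comm : forall c x y d z t,
    v c x y * v d z t = signb F c d *: (v d z t * v c x y);
  rf_square : forall x y, v false x y * v false x y = 0;
  rf_aa : forall x y z, uniq [:: x; y; z] ->
    v false x y * v false y z + v false y z * v false z x
    + v false z x * v false x y = 0;
  rf_ba : forall x y z, uniq [:: x; y; z] ->
    v true x y * v false y z + v true y z * v false z x
    + v true z x * v false x y + v false x y * v true y z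
    + v false y z * v true z x + v false z x * v true x y = 0;
  rf_cycle : forall c x y s, uniq [:: x, y & s] ->
    walk v x ((c, y) :: [seq (true, z) | z <- rcons s x]) = 0;
  rf_bcb : forall c x y z t, uniq [:: x; y; z; t] ->
    sum12 (bcb v c) x y z t = 0
}.

Section RfamilyTheory.
Variables (F : fieldType) (B : algType F) (X : finType).
Variables (v : bool -> X -> X -> B).
Hypothesis vR : Rfamily v.

Lemma rf_qcomm c x y d z t : @qcomm F B (v c x y) (v d z t).
Proof. by exists (signb F c d); apply: rf_comm. Qed.

(** The closed walks whose products vanish: distinct vertices, at least two edges,
    at most one of them an a, in any position. *)
Definition edge_cycle (s : seq (bool * X)) : bool :=
  [&& uniq (unzip2 s), (1 < size s)%N & (count (fun p => ~~ p.1) s <= 1)%N].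

Lemma edge_cycle_perm s t : perm_eq s t -> edge_cycle s = edge_cycle t.
Proof.
move=> st; rewrite /edge_cycle (perm_uniq (perm_map _ st)) (perm_size st).
by rewrite (seq.permP st).
Qed.

Lemma all_true_edges (s : seq (bool * X)) : count (fun p => ~~ p.1) s = 0%N ->
  s = [seq (true, z) | z <- unzip2 s].
Proof.
elim: s => //= [[[] y] s] IH //=; rewrite add0n => /IH <-; congr (_ :: _).
Qed.

Lemma cycle_head_eq0 c x y t : last y (unzip2 t) = x ->
  uniq (y :: unzip2 t) -> (0 < size t)%N -> count (fun p => ~~ p.1) t = 0%N ->
  walk v x ((c, y) :: t) = 0.
Proof.
move=> tx ut t0 /all_true_edges tE; rewrite tE.
move: ut t0 tx; rewrite -(size_map snd t) -/(unzip2 t).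
case/lastP: (unzip2 t) => // u z uz _; rewrite last_rcons => zx; subst z.
apply: (rf_cycle vR); move: uz; rewrite -rcons_cons rcons_uniq => /andP[xu yu].
by rewrite cons_uniq xu.
Qed.

Lemma split_false (s : seq (bool * X)) : (count (fun p => ~~ p.1) s <= 1)%N ->
  count (fun p => ~~ p.1) s = 0%N \/
  exists s1 y s2, [/\ s = s1 ++ (false, y) :: s2,
    count (fun p => ~~ p.1) s1 = 0%N & count (fun p => ~~ p.1) s2 = 0%N].
Proof.
elim: s => [|[[] y] s IH] /=; first by left.
  rewrite add0n => /IH[->|[s1 [z [s2 [-> h1 h2]]]]]; first by left.
  by right; exists ((true, y) :: s1), z, s2.
rewrite add1n ltnS leqn0 => /eqP s0; right.
by exists [::], y, s.
Qed.

(** The relations only put the a on the first edge; rotating the walk brings it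
    there. *)
Lemma cycle_eq0 x s : last x (unzip2 s) = x -> edge_cycle s -> walk v x s = 0.
Proof.
move=> sx sc; have /and3P[_ _ /split_false[s0|[s1 [y [s2 [sE h1 h2]]]]]] := sc.
  case: s s0 sx sc => [|[c y] t] //= /eqP; rewrite addn_eq0.
  by move=> /andP[_ /eqP t0] tx /and3P[ut tgt0 _]; apply: cycle_head_eq0.
move: sx sc; rewrite {}sE => sx sc; have [k ->] := walk_rot rf_qcomm sx.
rewrite (edge_cycle_perm (permEl (perm_catC _ _))) in sc.
have /and3P[us sgt1 _] := sc.
have {}sx : last y (unzip2 s2) = x.
  by move: sx; rewrite /unzip2 map_cat last_cat.
rewrite cat_cons cycle_head_eq0 ?scaler0 //.
- by rewrite /unzip2 map_cat last_cat sx.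
- by rewrite count_cat h1 h2.
Qed.
End RfamilyTheory.

Section RfamilyMorphism.
Variables (F : fieldType) (B C : algType F) (X : finType) (f : B -> C).
Hypothesis fA : algmorph f.
Variable v : bool -> X -> X -> B.
Local Notation fv := (fun c x y => f (v c x y)).

Lemma walk_morph x s : walk fv x s = f (walk v x s).
Proof.
case: fA => _ f1 fM.
by elim: s x => [|[c y] s IH] x /=; rewrite ?f1 // IH fM.
Qed.

Lemma Rfamily_morph : Rfamily v -> Rfamily fv.
Proof.
case: fA => fL f1 fM [dg an co sq aa ba cy zz]; split.
- by move=> c x; rewrite dg (lin0 fL).
- by move=> c x y; rewrite an -scaleN1r (linZ fL) scaleN1r.
- by move=> c x y d z t; rewrite -!fM co (linZ fL).
- by move=> x y; rewrite -fM sq (lin0 fL).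
- by move=> x y z /aa xyz; rewrite -!fM -!(linD fL) xyz (lin0 fL).
- by move=> x y z /ba xyz; rewrite -!fM -!(linD fL) xyz (lin0 fL).
- by move=> c x y s /(cy c); rewrite walk_morph => ->; rewrite (lin0 fL).
- move=> c x y z t /(zz c); rewrite /sum12 /bcb -!fM -!(linD fL) => ->.
  by rewrite (lin0 fL).
Qed.
End RfamilyMorphism.

(** * The universal property of R(X) *)

Section Universal.
Variables (F : fieldType) (X : finType).
Notation R := (Ralg F).
Notation pi := (qpi (@ideal_gen F (Rpres F X))).

Lemma Rvar_diag c (x : X) : Rvar F c x x = 0.
Proof. by rewrite /Rvar /frgen insubF ?eqxx //; apply: lin0 (qpi_linear _). Qed.

Section Relations.
Variables (B : algType F) (f : {malg F[{fmonom (Rgen X)}]} -> B).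
Hypothesis fL : linear f.
Hypothesis f1 : f 1 = 1.
Hypothesis fM : {morph f : x y / x * y}.
Local Notation v := (fun c x y => f (frgen F c x y)).

Let fD (x y : {malg F[{fmonom (Rgen X)}]}) : f (x + y) = f x + f y.
Proof. exact: linD fL x y. Qed.

Let fB k (x y : {malg F[{fmonom (Rgen X)}]}) : f (x - k *: y) = f x - k *: f y.
Proof. by rewrite -(linZ fL); exact: linB fL x _. Qed.

Lemma bpathE x s : f (bpath F x s) = walk v x [seq (true, z) | z <- s].
Proof. by elim: s x => [|y s IH] x /=; rewrite ?f1 // fM IH. Qed.

Lemma frgen_diag c x : frgen F c x x = 0 :> {malg F[{fmonom (Rgen X)}]}.
Proof. by rewrite /frgen insubF ?eqxx. Qed.

Lemma frgenE c x y (xy : x != y) :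
  frgen F c x y = << fmu ((c, exist _ (x, y) xy) : Rgen X) >>.
Proof. by rewrite /frgen (@insubT _ (fun p => p.1 != p.2) _ (x, y) xy). Qed.

Lemma f_sum12 c x y z t :
  f (\sum_(w <- words12 x y z t) (let: (w1, w2, w3, w4) := w in
     frgen F true w1 w2 * frgen F c w2 w3 * frgen F true w3 w4))
  = sum12 (bcb v c) x y z t.
Proof.
rewrite (lin_sum fL) -sum12E; apply: eq_bigr => -[[[p q] r] s] _.
by rewrite /bcb !fM.
Qed.

Lemma signbE (g h : Rgen X) : ksign F (Rdeg g) (Rdeg h) = signb F g.1 h.1.
Proof. by rewrite /ksign /signb; case: g h => [[] ?] [[] ?]. Qed.

(** Used in both directions: for the evaluation of words in a family it yields the
    morphism out of R(X), and for the projection onto R(X) it says that the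
    generators form a family. *)
Lemma Rfamily_rel : Rfamily v <-> forall r, Rrel r -> f r = 0.
Proof.
split=> [[dg an co sq aa ba cy zz] r|f0].
  case=> {r}[g h|c i j ij|i j ij|i j k ijk|i j k ijk|i j s ijs|i j s ijs
           |i j k l ijkl|i j k l ijkl].
  - rewrite signbE; case: g h => [c [[i j] ij]] [d [[k l] kl]].
    have /eqP := co c i j d k l; rewrite -subr_eq0 -!fM -fB => /eqP.
    by rewrite (frgenE c ij) (frgenE d kl).
  - by have /eqP := an c i j; rewrite -addr_eq0 addrC -fD => /eqP.
  - by have := sq i j; rewrite -fM.
  - by have := aa _ _ _ ijk; rewrite -!fM -!fD.
  - by have := ba _ _ _ ijk; rewrite -!fM -!fD.
  - by have := cy false _ _ _ ijs; rewrite /= -bpathE -fM.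
  - by have := cy true _ _ _ ijs; rewrite /= -bpathE -fM.
  - by rewrite f_sum12; exact: zz false _ _ _ _ ijkl.
  - by rewrite f_sum12; exact: zz true _ _ _ _ ijkl.
split.
- by move=> c x; rewrite frgen_diag (lin0 fL).
- move=> c x y; have [->|xy] := eqVneq x y; first by rewrite frgen_diag (lin0 fL) oppr0.
  by apply/eqP; rewrite -addr_eq0 addrC -(linD fL) f0 //; apply: Ranti.
- move=> c x y d z t.
  have [->|xy] := eqVneq x y; first by rewrite frgen_diag (lin0 fL) mul0r mulr0 scaler0.
  have [->|zt] := eqVneq z t; first by rewrite frgen_diag (lin0 fL) mul0r mulr0 scaler0.
  rewrite !frgenE; apply/eqP; rewrite -subr_eq0 -!fM -(linZ fL) -(linB fL).
  have := f0 _ (Rcomm F (c, exist _ (x, y) xy : {p : X * X | p.1 != p.2}) (d, exist _ (z, t) zt : {p : X * X | p.1 != p.2})).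
  by rewrite signbE => ->.
- move=> x y; have [->|xy] := eqVneq x y; first by rewrite frgen_diag (lin0 fL) mul0r.
  by rewrite -fM f0 //; apply: Rsquare.
- by move=> x y z xyz; rewrite -!fM -!(linD fL) f0 //; apply: Raa.
- by move=> x y z xyz; rewrite -!fM -!(linD fL) f0 //; apply: Rba.
- move=> c x y s xys /=; rewrite -bpathE -fM f0 //.
  by case: c; [apply: Rcycle_b | apply: Rcycle_ab].
- move=> c x y z t xyzt; rewrite -f_sum12 f0 //.
  by case: c; [apply: Rbbb | apply: Rbab].
Qed.
End Relations.

Lemma Rvar_family : Rfamily (@Rvar F X).
Proof.
have [_ piR] := @Rfamily_rel (R X) pi (qpi_linear _) (qpi1 _) (@qpiM F (Rpres F X)).
by apply: piR => r; apply: (@qpi_rel F (Rpres F X)).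
Qed.

Section Lift.
Variables (B : algType F) (v : bool -> X -> X -> B).
Hypothesis vR : Rfamily v.

Definition Rlift : R X -> B :=
  @palg_lift F (Rpres F X) B (fun g : Rgen X => v g.1 (val g.2).1 (val g.2).2).

Lemma Rlift_rel r : @prel _ (Rpres F X) r ->
  @freval F (Rpres F X) B (fun g : Rgen X => v g.1 (val g.2).1 (val g.2).2) r = 0.
Proof.
move: r; set ev := @freval _ _ _ _.
have evL : linear ev by apply: freval_linear.
have [evR _] := Rfamily_rel evL (@freval1 F (Rpres F X) B _) (@frevalM F (Rpres F X) B _).
apply: evR; suff E c x y : ev (frgen F c x y) = v c x y.
  have -> : (fun c x y => ev (frgen F c x y)) = v.
    by apply/boolp.funext => c; apply/boolp.funext => x; apply/boolp.funext => y.
  by [].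
have [->|xy] := eqVneq x y; first by rewrite frgen_diag (lin0 evL) (rf_diag vR).
by rewrite (frgenE _ xy) /ev (@frevalX F (Rpres F X)).
Qed.

Lemma Rlift_algmorph : algmorph Rlift.
Proof.
split; first exact: palg_lift_linear Rlift_rel.
  exact: palg_lift1 Rlift_rel.
exact: palg_liftM Rlift_rel.
Qed.

Lemma Rlift_var c x y : Rlift (Rvar F c x y) = v c x y.
Proof.
have [->|xy] := eqVneq x y.
  by rewrite Rvar_diag (rf_diag vR); case: Rlift_algmorph => /lin0.
rewrite /Rvar (frgenE _ xy).
exact: (@palg_lift_var F (Rpres F X) B _ Rlift_rel (c, exist _ (x, y) xy)).
Qed.
End Lift.

Lemma Rlift_bgmorph (B : bgAlgType F) (v : bool -> X -> X -> B) : Rfamily v ->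
  (forall c x y, homog ((Posz (c : bool), Posz 1) : bideg) (v c x y)) -> bgmorph (Rlift v).
Proof.
move=> vR vh; split; first exact: Rlift_algmorph.
by apply: (@palg_lift_homog F (Rpres F X) B _ (Rlift_rel vR)) => g; apply: vh.
Qed.

Lemma Rext (B : algType F) (f g : R X -> B) : algmorph f -> algmorph g ->
  (forall c x y, f (Rvar F c x y) = g (Rvar F c x y)) -> f =1 g.
Proof.
move=> fA gA fg; apply: (palg_ext fA gA) => u; rewrite -[u]/(u : Rgen X).
by rewrite -(RvarE F u).
Qed.
End Universal.

(** * Gluing two families *)

Section Glue.
Variables (F : fieldType) (B : algType F) (I J : finType).
Variables (u : bool -> option I -> option I -> B) (w : bool -> J -> J -> B).
Hypotheses (uR : Rfamily u) (wR : Rfamily w).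
Hypothesis uwC : forall c x y d z t,
  u c x y * w d z t = signb F c d *: (w d z t * u c x y).

Definition glue (c : bool) (x y : I + J) : B :=
  match x, y with
  | inl i, inl i' => u c (Some i) (Some i')
  | inl i, inr _ => u c (Some i) None
  | inr _, inl i => u c None (Some i)
  | inr j, inr j' => w c j j'
  end.

Definition collapse (x : I + J) : option I := if x is inl i then Some i else None.

(** This is why a relation with at most one index in J is a relation for [u]. *)
Lemma uniq_collapse (s : seq (I + J)) : uniq s ->
  (count (fun x => ~~ collapse x) s <= 1)%N -> uniq (map collapse s).
Proof.
elim: s => //= x s IH /andP[xs us] c1; rewrite IH ?andbT //; last first.
  exact: leq_trans (leq_addl _ _) c1.
apply/mapP => -[y ys xy]; case: x y xs xy ys c1 => [i|j] [i'|j'] //= xs.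
  by move=> [ii'] ys; rewrite ii' ys in xs.
move=> _ ys; rewrite add1n ltnS leqn0 => /eqP c0.
suff : (0 < count (fun x => ~~ collapse x) s)%N by rewrite c0.
by rewrite -has_count; apply/hasP; exists (inr j').
Qed.

Lemma wuC c x y d z t :
  w c x y * u d z t = signb F c d *: (u d z t * w c x y).
Proof.
by rewrite uwC scalerA /signb andbC -exprD addnn -muln2 exprM sqrr_sign scale1r.
Qed.

Lemma glue_comm c x y d z t :
  glue c x y * glue d z t = signb F c d *: (glue d z t * glue c x y).
Proof.
case: x y z t => [x|x] [y|y] [z|z] [t|t] /=;
  by [exact: (rf_comm uR) | exact: (rf_comm wR) | exact: uwC | exact: wuC].
Qed.

Lemma glue_qcomm c x y d z t : @qcomm F B (glue c x y) (glue d z t).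
Proof. by exists (signb F c d); apply: glue_comm. Qed.

Lemma glue_anti c x y : glue c y x = - glue c x y.
Proof.
by case: x y => [x|x] [y|y]; [exact: (rf_anti uR).. | exact: (rf_anti wR)].
Qed.

(** ** Cycle relations *)

Lemma split_inl (s : seq (bool * (I + J))) :
  (exists s', s = [seq (p.1, inl p.2) | p <- s']) \/
  exists s1 c j s2, s = [seq (p.1, inl p.2) | p <- s1] ++ (c, inr j) :: s2.
Proof.
elim: s => [|[c [i|j]] s IH]; first by left; exists [::].
  case: IH => [[s' ->]|[s1 [d [j [s2 ->]]]]]; first by left; exists ((c, i) :: s').
  by right; exists ((c, i) :: s1), d, j, s2.
by right; exists [::], c, j, s.
Qed.

Lemma split_inr (s : seq (bool * (I + J))) :
  (exists s', s = [seq (p.1, inr p.2) | p <- s']) \/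
  exists s1 c i s2, s = [seq (p.1, inr p.2) | p <- s1] ++ (c, inl i) :: s2.
Proof.
elim: s => [|[c [i|j]] s IH]; first by left; exists [::].
  by right; exists [::], c, i, s.
case: IH => [[s' ->]|[s1 [d [i [s2 ->]]]]]; first by left; exists ((c, j) :: s').
by right; exists ((c, j) :: s1), d, i, s2.
Qed.

Lemma last_inl (x : I) (s : seq (bool * I)) :
  last (inl x) (unzip2 [seq (p.1, inl p.2) | p <- s]) = inl (last x (unzip2 s)) :> I + J.
Proof. by elim: s x => //= -[c y] s IH x; apply: IH. Qed.

Lemma last_inr (x : J) (s : seq (bool * J)) :
  last (inr x) (unzip2 [seq (p.1, inr p.2) | p <- s]) = inr (last x (unzip2 s)) :> I + J.
Proof. by elim: s x => //= -[c y] s IH x; apply: IH. Qed.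

Lemma walk_inl x s :
  walk glue (inl x) [seq (p.1, inl p.2) | p <- s] =
  walk u (Some x) [seq (p.1, Some p.2) | p <- s].
Proof. by elim: s x => //= -[c y] s IH x /=; rewrite IH. Qed.

Lemma walk_inr x s :
  walk glue (inr x) [seq (p.1, inr p.2) | p <- s] = walk w x s.
Proof. by elim: s x => //= -[c y] s IH x /=; rewrite IH. Qed.

Lemma walk_arc x s c j :
  walk glue (inl x) (rcons [seq (p.1, inl p.2) | p <- s] (c, inr j)) =
  walk u (Some x) (rcons [seq (p.1, Some p.2) | p <- s] (c, None)).
Proof. by elim: s x => //= -[d y] s IH x /=; rewrite IH. Qed.

Lemma unzip2_map (X Y : Type) (f : X -> Y) (s : seq (bool * X)) :
  unzip2 [seq (p.1, f p.2) | p <- s] = map f (unzip2 s).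
Proof. by rewrite /unzip2 -!map_comp. Qed.

Lemma count_a_map (X Y : Type) (f : X -> Y) (s : seq (bool * X)) :
  count (fun p => ~~ p.1) [seq (p.1, f p.2) | p <- s] = count (fun p => ~~ p.1) s.
Proof. by rewrite count_map. Qed.

Lemma edge_cycle_map (X Y : finType) (f : X -> Y) (s : seq (bool * X)) :
  injective f -> edge_cycle [seq (p.1, f p.2) | p <- s] = edge_cycle s.
Proof.
by move=> fI; rewrite /edge_cycle unzip2_map map_inj_uniq // size_map count_a_map.
Qed.

(** A closed walk based at a point of J either stays in J, or contains an arc from
    J through I to J; this arc closes up when J is collapsed to one point. *)
Lemma glue_cycle_inr j s : last (inr j) (unzip2 s) = inr j -> edge_cycle s ->
  walk glue (inr j) s = 0.
Proof.
case: (split_inr s) => [[s' ->]|[s1 [c [i [s2 ->]]]]].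
  rewrite last_inr => -[js'] sc; rewrite walk_inr (cycle_eq0 wR) //.
  by rewrite edge_cycle_map // in sc; move=> ? ? [].
rewrite walk_cat last_inr /unzip2 map_cat last_cat /=.
case: (split_inl s2) => [[s' ->]|[s3 [d [j' [s4 ->]]]]].
  by rewrite -/(unzip2 _) last_inl.
move=> _ /and3P[us _ s1c].
(* The arc: from the last vertex before [i], which is in J, to the next one in J. *)
suff arc : u c None (Some i) *
    walk u (Some i) (rcons [seq (p.1, Some p.2) | p <- s3] (d, None)) = 0.
  by rewrite -cat_rcons walk_cat walk_arc (mulrA (u _ _ _)) arc mul0r mulr0.
apply: (cycle_eq0 uR (s := (c, Some i) :: rcons _ _)).
  by rewrite /unzip2 /= map_rcons last_rcons.
apply/and3P; split.
- have -> : unzip2 ((c, Some i) :: rcons [seq (p.1, Some p.2) | p <- s3] (d, None)) =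
      rcons (map Some (i :: unzip2 s3)) None.
    by rewrite /unzip2 /= map_rcons -!map_comp.
  rewrite rcons_uniq map_inj_uniq; last by move=> ? ? [].
  apply/andP; split; first by apply/mapP => -[].
  move: us; rewrite /unzip2 map_cat cat_uniq => /and3P[_ _].
  rewrite -cat_cons map_cat cat_uniq => /andP[us _].
  move: us; rewrite map_cons -/(unzip2 _) unzip2_map -(map_cons inl).
  by rewrite map_inj_uniq // => ? ? [].
- by rewrite /= size_rcons.
move: s1c; rewrite /= -cats1 !count_cat /= !count_cat /= !count_a_map; lia.
Qed.

Lemma glue_cycle x s : last x (unzip2 s) = x -> edge_cycle s -> walk glue x s = 0.
Proof.
case: (split_inl s) => [[s' ->]|[s1 [c [j [s2 ->]]]]] sx sc.
  move: sx sc; case: x => [i|j]; last by case: s' => // p s'; rewrite /= last_inl.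
  rewrite last_inl => -[is'] sc; rewrite walk_inl (cycle_eq0 uR) //.
    by rewrite unzip2_map last_map is'.
  by move: sc; rewrite !edge_cycle_map // => ? ? [].
(* Rotate so that the walk starts at its first vertex in J. *)
move: sx sc; rewrite -cat_rcons => sx sc; have [k ->] := walk_rot glue_qcomm sx.
rewrite (edge_cycle_perm (permEl (perm_catC _ _))) in sc.
have h1 : last x (unzip2 (rcons [seq (p.1, inl p.2) | p <- s1] (c, inr j))) = inr j.
  by rewrite /unzip2 map_rcons last_rcons.
rewrite h1 glue_cycle_inr ?scaler0 //.
by rewrite /unzip2 map_cat map_rcons last_cat last_rcons.
Qed.

(** ** Relations with two or three indices *)

(** After collapsing, both factors have the same two indices: the product is zero
    by the shortest cycle relations, or by the square relation when both are a. *)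
Lemma glue_backtrack c d j i j' : glue c (inr j) (inl i) * glue d (inl i) (inr j') = 0.
Proof.
rewrite /glue; case: c; last case: d.
- rewrite (rf_comm uR) -[X in _ *: X]/(u d (Some i) None * u true None (Some i)).
  have := rf_cycle uR d (x := Some i) (y := None) (s := [::]) isT.
  by rewrite /= mulr1 => ->; rewrite scaler0.
- have := rf_cycle uR false (x := None) (y := Some i) (s := [::]) isT.
  by rewrite /= mulr1.
- by rewrite (rf_anti uR) mulNr (rf_square uR) oppr0.
Qed.

Lemma false_comm c x y z t : glue c x y * glue false z t = glue false z t * glue c x y.
Proof. by rewrite glue_comm /signb andbF scale1r. Qed.

Lemma glue_square x y : glue false x y * glue false x y = 0.
Proof. by case: x y => [x|x] [y|y]; rewrite /= ?(rf_square uR) ?(rf_square wR). Qed.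

(** Like its six-term analogue below, it lets the point of I be the first index
    when the other two are in J. *)
Lemma rotate_sum (V : nmodType) (x y z : V) : x + y + z = 0 -> y + z + x = 0.
Proof. by move=> <-; rewrite addrC addrA. Qed.

Lemma uniq_inr (s : seq J) : uniq (map inr s : seq (I + J)) -> uniq s.
Proof. by rewrite map_inj_uniq // => ? ? []. Qed.

Lemma glue_aa x y z : uniq [:: x; y; z] ->
  glue false x y * glue false y z + glue false y z * glue false z x
  + glue false z x * glue false x y = 0.
Proof.
have LRR i j k : glue false (inl i) (inr j) * glue false (inr j) (inr k)
    + glue false (inr j) (inr k) * glue false (inr k) (inl i)
    + glue false (inr k) (inl i) * glue false (inl i) (inr j) = 0.
  rewrite glue_backtrack addr0 false_comm -mulrDr (glue_anti false (inl i) (inr k)).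
  by rewrite subrr mulr0.
case: x y z => [x|x] [y|y] [z|z] xyz; try exact: rf_aa uR _ _ _ (uniq_collapse xyz isT).
- exact: LRR.
- exact/rotate_sum/rotate_sum/LRR.
- exact/rotate_sum/LRR.
- exact: rf_aa wR _ _ _ (uniq_inr (s := [:: x; y; z]) xyz).
Qed.

Lemma rotate_sum6 (V : nmodType) (x y z t p q : V) :
  x + y + z + t + p + q = 0 -> y + z + x + p + q + t = 0.
Proof. by move=> <-; rewrite [LHS](ACl (3*1*2*6*4*5))%AC. Qed.

Lemma glue_ba x y z : uniq [:: x; y; z] ->
  glue true x y * glue false y z + glue true y z * glue false z x
  + glue true z x * glue false x y + glue false x y * glue true y z
  + glue false y z * glue true z x + glue false z x * glue true x y = 0.
Proof.
have LRR i j k : glue true (inl i) (inr j) * glue false (inr j) (inr k)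
    + glue true (inr j) (inr k) * glue false (inr k) (inl i)
    + glue true (inr k) (inl i) * glue false (inl i) (inr j)
    + glue false (inl i) (inr j) * glue true (inr j) (inr k)
    + glue false (inr j) (inr k) * glue true (inr k) (inl i)
    + glue false (inr k) (inl i) * glue true (inl i) (inr j) = 0.
  rewrite !glue_backtrack !addr0 !(glue_anti _ (inl i) (inr k)) !mulrN.
  rewrite -(false_comm true (inr j)) -(false_comm true (inl i) (inr k)).
  by rewrite -[glue false (inl i) (inr j)]/(glue false (inl i) (inr k)) subrK subrr.
case: x y z => [x|x] [y|y] [z|z] xyz; try exact: rf_ba uR _ _ _ (uniq_collapse xyz isT).
- exact: LRR.
- exact/rotate_sum6/rotate_sum6/LRR.
- exact/rotate_sum6/LRR.
- exact: rf_ba wR _ _ _ (uniq_inr (s := [:: x; y; z]) xyz).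
Qed.

(** ** The 12-term relations *)

(** The three antisymmetry signs of a reversal cancel against the Koszul sign of
    the reversed product: that of two odd factors when [c] is a, that of three
    odd factors when [c] is b, both equal to -1. *)
Lemma bcb_rev c x y z t : bcb glue c t z y x = bcb glue c x y z t.
Proof.
rewrite /bcb !(glue_anti _ z t, glue_anti _ y z, glue_anti _ x y).
rewrite mulrNN mulrN -(mulrA (glue true z t)).
rewrite (glue_comm c y z true x y) -scalerAr mulrA (glue_comm true z t).
rewrite -scalerAl scalerA -(mulrA (glue true x y)) (glue_comm true z t).
rewrite -scalerAr scalerA mulrA /signb.
by case: c; rewrite /= !(expr0, expr1, mulr1, mulrN1, opprK, scaleN1r, scale1r).
Qed.

(** The words where the point of I is not at an end vanish. The other six share the
    factor from the point of I to J and leave, in the indices of J, the 6-term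
    relation if [c] is a, and three cancelling pairs if [c] is b. *)
Lemma glue_bcb_LRRR c i j k l : uniq [:: j; k; l] ->
  sum12 (bcb glue c) (inl i) (inr j) (inr k) (inr l) = 0.
Proof.
move=> jkl; rewrite /sum12.
have b2 p q r : bcb glue c (inr p) (inl i) (inr q) (inr r) = 0.
  by rewrite /bcb glue_backtrack mul0r.
have b3 p q r : bcb glue c (inr p) (inr q) (inl i) (inr r) = 0.
  by rewrite /bcb -mulrA glue_backtrack mulr0.
rewrite !(b2, b3) !addr0 /bcb /= -!(mulrA (u true (Some i) None)) -!mulrDr.
rewrite (_ : _ + _ = 0) ?mulr0 //.
case: c {b2 b3}.
  have wC x y z t : w true x y * w true z t = - (w true z t * w true x y).
    by rewrite (rf_comm wR) /signb /= expr1 scaleN1r.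
  have rev x y z : w true z y * w true y x = - (w true x y * w true y z).
    by rewrite (rf_anti wR true y z) (rf_anti wR true x y) mulrNN (wC y z).
  rewrite [LHS](ACl (1*6*2*4*3*5))%AC /=.
  by rewrite (rev j k l) (rev k j l) (rev j l k) subrr add0r subrr add0r subrr.
have flip x y z : w false y x * w true x z = w true z x * w false x y.
  rewrite (rf_anti wR false x y) (rf_anti wR true z x) mulrNN (rf_comm wR).
  by rewrite /signb scale1r.
rewrite (flip j k l) (flip l j k) (flip k l j) -[RHS](rf_ba wR jkl).
by rewrite [LHS](ACl (6*3*2*1*5*4))%AC.
Qed.

(** If the two points of J are adjacent in a word, exchanging them changes the sign
    of the monomial. Otherwise they are separated by one or two points of I, and
    the monomial contains a closed walk at the added point. *)
Lemma glue_bcb_LLRR c i i' j j' : i != i' ->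
  sum12 (bcb glue c) (inl i) (inl i') (inr j) (inr j') = 0.
Proof.
move=> ii'; rewrite /sum12.
have z0 x p q q' : bcb glue c x (inr q) (inl p) (inr q') = 0.
  by rewrite /bcb -mulrA glue_backtrack mulr0.
have z1 x p q q' : bcb glue c (inr q) (inl p) (inr q') x = 0.
  by rewrite /bcb glue_backtrack mul0r.
have z2 p p' q q' : p != p' -> bcb glue c (inr q) (inl p) (inl p') (inr q') = 0.
  move=> pp'; rewrite /bcb /=.
  have := cycle_eq0 uR (x := None)
    (s := [:: (true, Some p); (c, Some p'); (true, None)]) erefl.
  rewrite /= mulr1 mulrA; apply; rewrite /edge_cycle /= !inE /= orbF.
  by rewrite (inj_eq Some_inj) pp'; case: (c).
have e1 p p' : bcb glue c (inl p) (inl p') (inr j') (inr j) =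
    - bcb glue c (inl p) (inl p') (inr j) (inr j').
  by rewrite /bcb (glue_anti true (inr j) (inr j')) mulrN.
have e2 : bcb glue c (inl i) (inr j') (inr j) (inl i') =
    - bcb glue c (inl i) (inr j) (inr j') (inl i').
  by rewrite /bcb (glue_anti c (inr j) (inr j')) mulrN mulNr.
rewrite !(z0, z1) z2 // z2; last by rewrite eq_sym.
by rewrite !addr0 !e1 e2 subrr add0r subrr add0r subrr.
Qed.

(** Adjacent transpositions sort the indices, so that only the number of them in J
    matters. *)
Lemma sorted_quadruple (Q : I + J -> I + J -> I + J -> I + J -> Prop) :
  (forall x y z t, Q x y z t -> Q y x z t) ->
  (forall x y z t, Q x y z t -> Q x z y t) ->
  (forall x y z t, Q x y z t -> Q x y t z) ->
  (forall i1 i2 i3 i4, Q (inl i1) (inl i2) (inl i3) (inl i4)) ->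
  (forall i1 i2 i3 j1, Q (inl i1) (inl i2) (inl i3) (inr j1)) ->
  (forall i1 i2 j1 j2, Q (inl i1) (inl i2) (inr j1) (inr j2)) ->
  (forall i1 j1 j2 j3, Q (inl i1) (inr j1) (inr j2) (inr j3)) ->
  (forall j1 j2 j3 j4, Q (inr j1) (inr j2) (inr j3) (inr j4)) ->
  forall x y z t, Q x y z t.
Proof.
move=> s12 s23 s34 q0 q1 q2 q3 q4 [x|x] [y|y] [z|z] [t|t]; auto 6.
Qed.

Lemma glue_bcb c x y z t : uniq [:: x; y; z; t] -> sum12 (bcb glue c) x y z t = 0.
Proof.
move: x y z t; apply: sorted_quadruple => [x y z t Q|x y z t Q|x y z t Q|||||].
- rewrite (sum12_swap12 (bcb_rev c)) => u4; apply: Q.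
  by rewrite (perm_uniq (_ : perm_eq _ [:: y; x; z; t])) //; apply/seq.permP => p /=; lia.
- rewrite (sum12_swap23 (bcb_rev c)) => u4; apply: Q.
  by rewrite (perm_uniq (_ : perm_eq _ [:: x; z; y; t])) //; apply/seq.permP => p /=; lia.
- rewrite (sum12_swap34 (bcb_rev c)) => u4; apply: Q.
  by rewrite (perm_uniq (_ : perm_eq _ [:: x; y; t; z])) //; apply/seq.permP => p /=; lia.
- by move=> i1 i2 i3 i4 u4; exact: rf_bcb uR c _ _ _ _ (uniq_collapse u4 isT).
- by move=> i1 i2 i3 j1 u4; exact: rf_bcb uR c _ _ _ _ (uniq_collapse u4 isT).
- move=> i1 i2 j1 j2; rewrite cons_uniq inE negb_or => /andP[/andP[i12 _] _].
  exact: glue_bcb_LLRR.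
- move=> i1 j1 j2 j3; rewrite cons_uniq => /andP[_ /(uniq_inr (s := [:: j1; j2; j3]))].
  exact: glue_bcb_LRRR.
move=> j1 j2 j3 j4 u4.
exact: rf_bcb wR c _ _ _ _ (uniq_inr (s := [:: j1; j2; j3; j4]) u4).
Qed.

Lemma Rfamily_glue : Rfamily glue.
Proof.
split; [|exact: glue_anti|exact: glue_comm|exact: glue_square|exact: glue_aa
       |exact: glue_ba| |exact: glue_bcb].
  by move=> c [x|x] /=; rewrite ?(rf_diag uR) ?(rf_diag wR).
move=> c x y s /=; rewrite inE negb_or -andbA => /and4P[xy xs ys us].
apply: (glue_cycle (s := (c, y) :: [seq (true, z) | z <- rcons s x])).
  by rewrite /= /unzip2 -map_comp map_id last_rcons.
rewrite /edge_cycle /= /unzip2 -map_comp map_id size_map size_rcons /=.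
rewrite mem_rcons inE eq_sym negb_or xy ys rcons_uniq xs us /=.
by rewrite count_map count_pred0; case: (c).
Qed.
End Glue.

(** * Algebra morphisms between tensor products *)

Section TensorMorphisms.
Variable F : fieldType.

Lemma bgmorph_comp (A B C : bgAlgType F) (g : B -> C) (f : A -> B) :
  bgmorph f -> bgmorph g -> bgmorph (fun x => g (f x)).
Proof.
move=> [fA fh] [gA gh]; split; first exact: algmorph_comp fA gA.
by move=> d x /fh/gh.
Qed.

Lemma ksign1 (d e : bideg) : ksign F d e = 1 \/ ksign F d e = -1.
Proof.
rewrite /ksign; case: (_ * _) => n.
  by rewrite -exprnP -signr_odd; case: odd; [right|left].
by rewrite NegzE -exprnN -exprVn invrN1 -signr_odd; case: odd; [right|left].
Qed.

Lemma ksignK (d e : bideg) : ksign F d e * ksign F d e = 1.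
Proof. by case: (ksign1 d e) => ->; rewrite ?mulrNN mulr1. Qed.

Lemma ksignC (d e : bideg) : ksign F d e = ksign F e d.
Proof. by rewrite /ksign mulrC. Qed.

Lemma lin_comb (U V : lmodType F) (f g : U -> V) c :
  linear f -> linear g -> linear (fun x => c *: f x + g x).
Proof.
move=> fL gL k x y; rewrite fL gL !scalerDr !scalerA addrACA.
by rewrite [c * k]mulrC.
Qed.

(** Multiplicativity at one pair of elements, for abstract algebras: instantiating
    it keeps the products in nested tensor algebras folded. *)
Lemma morphM_at (U V : algType F) (f : U -> V) (x y p : U) (x' y' q : V) k l m n :
  linear f -> f x = x' -> f y = y' -> f p = q ->
  x * y = k *: (l *: p) -> x' * y' = m *: (n *: q) -> k * l = m * n ->
  f (x * y) = f x * f y.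
Proof.
by move=> fL -> -> fp -> -> klmn; rewrite !scalerA -klmn (linZ fL) fp.
Qed.

Section MorphismLinear.
Variables (A B : algType F) (f : A -> B).
Hypothesis fL : linear f.

Lemma lin_mull u : linear (fun t => f (t * u)).
Proof. by move=> c x y; rewrite mulrDl -scalerAl fL. Qed.

Lemma lin_mulr u : linear (fun t => f (u * t)).
Proof. by move=> c x y; rewrite mulrDr -scalerAr fL. Qed.

Lemma mull_lin v : linear (fun t => f t * v).
Proof. by move=> c x y; rewrite fL mulrDl -scalerAl. Qed.

Lemma mulr_lin v : linear (fun t => v * f t).
Proof. by move=> c x y; rewrite fL mulrDr -scalerAr. Qed.
End MorphismLinear.

Section Inclusions.
Variables A B : bgAlgType F.

Lemma incl_left_morph : algmorph (fun x : A => (x ⊗ (1 : B))%R).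
Proof.
split=> [c x y| //|x y]; first by rewrite pureDl pureZl.
move: y; apply: homog_ind => [|y y' hy hy'|d y dy].
- by rewrite mulr0 pure0l mulr0.
- by rewrite mulrDr !pureDl mulrDr hy hy'.
by rewrite (tens_mulE _ _ (homog1 B) dy) ksign0l scale1r mulr1.
Qed.

Lemma incl_right_morph : algmorph (fun y : B => ((1 : A) ⊗ y)%R).
Proof.
split=> [c x y| //|x y]; first by rewrite pureDr pureZr.
move: x; apply: homog_ind => [|x x' hx hx'|d x dx].
- by rewrite mul0r pure0r mul0r.
- by rewrite mulrDl !pureDr mulrDl hx hx'.
by rewrite (tens_mulE _ _ dx (homog1 A)) ksign0r scale1r mulr1.
Qed.

Lemma incl_comm d e (x : A) (y : B) : homog d x -> homog e y ->
  (x ⊗ (1 : B)) * ((1 : A) ⊗ y) = ksign F d e *: (((1 : A) ⊗ y) * (x ⊗ (1 : B))).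
Proof.
move=> dx ey; rewrite (tens_mulE _ _ (homog1 B) (homog1 A)) (tens_mulE _ _ ey dx).
by rewrite ksign0l scale1r scalerA [ksign F e d]ksignC ksignK scale1r !mul1r !mulr1.
Qed.
End Inclusions.

Section Tmap.
Variables (A B A' B' : bgAlgType F) (f : A -> A') (g : B -> B').

Lemma tmap_bilin : linear f -> linear g -> bilin (fun x y => (f x ⊗ g y)%R).
Proof.
move=> fL gL; split=> [y|x] c z z'; first by rewrite fL pureDl pureZl.
by rewrite gL pureDr pureZr.
Qed.

Lemma tmap_linear : linear f -> linear g -> linear (tmap f g).
Proof. by move=> fL gL; apply/tlift_linear/tmap_bilin. Qed.

Lemma tmapE x y : linear f -> linear g -> tmap f g (x ⊗ y)%R = (f x ⊗ g y)%R.
Proof. by move=> fL gL; apply: (tliftE (tmap_bilin fL gL)). Qed.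

(** The Koszul signs on the two sides agree because [f] and [g] preserve degrees. *)
Lemma tmap_algmorph : bgmorph f -> bgmorph g -> algmorph (tmap f g).
Proof.
move=> [[fL f1 fM] fh] [[gL g1 gM] gh].
have tL := tmap_linear fL gL; split=> //.
  by rewrite -[1]/((1 : A) ⊗ (1 : B)) tmapE // f1 g1.
move=> t u; move: t; apply: tens_lin_eq.
- exact: lin_mull tL _.
- exact: mull_lin tL _.
move=> d e x y dx ey; move: u; apply: tens_lin_eq.
- exact: lin_mulr tL _.
- exact: mulr_lin tL _.
move=> d' e' x' y' dx' ey'.
rewrite (tens_mulE _ _ ey dx') (linZ tL) !tmapE // fM gM.
by rewrite (tens_mulE _ _ (gh _ _ ey) (fh _ _ dx')).
Qed.
End Tmap.

Section Tassoc.
Variables A B C : bgAlgType F.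

Lemma tassoc_bilin2 (z : C) :
  bilin (fun (x : A) (y : B) => (x ⊗ (y ⊗ z : (B ⊗ C)%type))%R).
Proof.
split=> [y|x] c u u'; first by rewrite pureDl pureZl.
by rewrite [((c *: u + u') ⊗ z)%R]pureDl pureZl pureDr pureZr.
Qed.

Lemma tassoc_bilin : bilin (fun (t : (A ⊗ B)%type) (z : C) =>
  tlift (fun (x : A) (y : B) => (x ⊗ (y ⊗ z : (B ⊗ C)%type))%R) t).
Proof.
pose L (z : C) : (A ⊗ B)%type -> (A ⊗ (B ⊗ C))%type :=
  tlift (fun (x : A) (y : B) => (x ⊗ (y ⊗ z : (B ⊗ C)%type))%R).
have LL z : linear (L z) := tlift_linear (tassoc_bilin2 z).
have LE z x y : L z (x ⊗ y)%R = (x ⊗ (y ⊗ z))%R := tliftE (tassoc_bilin2 z) x y.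
split=> [z|t]; first exact: LL.
change (linear (fun z => L z t)); move=> c z z'; move: {LL}LE (LL); move: L => L LE LL.
move: t; apply: (@tens_lin_eq _ _ _ _ (L (c *: z + z')) (fun t => c *: L z t + L z' t)).
- exact: LL.
- exact: lin_comb (LL z) (LL z').
move=> d e x y _ _; rewrite !LE.
by rewrite [(y ⊗ _)%R]pureDr pureZr pureDr pureZr.
Qed.

Lemma tassoc_linear : linear (@tassoc F A B C).
Proof. exact: tlift_linear tassoc_bilin. Qed.

Lemma tassocE (x : A) (y : B) (z : C) : tassoc (x ⊗ y ⊗ z)%R = (x ⊗ (y ⊗ z))%R.
Proof. by rewrite /tassoc (tliftE tassoc_bilin) (tliftE (tassoc_bilin2 z)). Qed.

Lemma tens3_lin_eq (W : lmodType F) (f g : ((A ⊗ B) ⊗ C)%type -> W) :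
  linear f -> linear g ->
  (forall d e k x y z, homog d x -> homog e y -> homog k z ->
    f (x ⊗ y ⊗ z)%R = g (x ⊗ y ⊗ z)%R) -> f =1 g.
Proof.
move=> fL gL fg; apply: tens_lin_eq => // _ k t z _ kz.
have pL : linear (fun t : (A ⊗ B)%type => (t ⊗ z)%R).
  by move=> c u u'; rewrite pureDl pureZl.
move: t; apply: tens_lin_eq; [exact: lin_comp pL fL | exact: lin_comp pL gL |].
by move=> d e x y dx ey; apply: fg dx ey kz.
Qed.

Lemma tassoc_algmorph : algmorph (@tassoc F A B C).
Proof.
have tL := tassoc_linear; split=> //; first exact: tassocE.
move=> t u; move: t; apply: tens3_lin_eq.
- exact: lin_mull tL _.
- exact: mull_lin tL _.
move=> d e k x y z dx ey kz; move: u; apply: tens3_lin_eq.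
- exact: lin_mulr tL _.
- exact: mulr_lin tL _.
move=> d' e' k' x' y' z' dx' ey' kz'.
have EL := tens_mulE (x ⊗ y)%R z' kz (homog_pure dx' ey').
rewrite (tens_mulE _ _ ey dx') pureZl in EL.
have ER := tens_mulE x (y' ⊗ z')%R (homog_pure ey kz) dx'.
rewrite (tens_mulE _ _ kz ey') pureZr in ER.
apply: morphM_at tL (tassocE _ _ _) (tassocE _ _ _) (tassocE _ _ _) EL ER _.
by rewrite ksignDl ksignDr mulrAC [ksign F k d' * _]mulrC.
Qed.
End Tassoc.

Section Tswap.
Variables A B : bgAlgType F.

Lemma tswap_linear : linear (@tswap F A B).
Proof.
apply/tlift_linear/wsum_bilin; split=> [y|x] c z z'.
  by rewrite pureDr pureZr.
by rewrite pureDl pureZl.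
Qed.

Lemma tswapE d e x y : homog d x -> homog e y ->
  @tswap F A B (x ⊗ y)%R = ksign F d e *: (y ⊗ x)%R.
Proof.
have sB : bilin (fun (x : A) (y : B) => (y ⊗ x)%R).
  by split=> [v|u] c z z'; rewrite ?pureDr ?pureZr // pureDl pureZl.
move=> dx ey; rewrite /tswap tliftE; last exact: wsum_bilin.
exact: (wsumE _ sB dx ey).
Qed.

(** Multiplicativity is where the Koszul sign in the symmetry is needed: the signs
    of the two sides differ by the square of the sign between the inner factors. *)
Lemma tswap_bgmorph : bgmorph (@tswap F A B).
Proof.
have tL := tswap_linear; split; first split=> //.
- by rewrite -[1]/((1 : A) ⊗ (1 : B)) (tswapE (homog1 A) (homog1 B)) ksign0l scale1r.
- move=> t u; move: t; apply: tens_lin_eq.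
  + exact: lin_mull tL _.
  + exact: mull_lin tL _.
  move=> d e x y dx ey; move: u; apply: tens_lin_eq.
  + exact: lin_mulr tL _.
  + exact: mulr_lin tL _.
  move=> d' e' x' y' dx' ey'.
  rewrite (tens_mulE _ _ ey dx') (linZ tL) (tswapE (homogM dx dx') (homogM ey ey')).
  rewrite (tswapE dx ey) (tswapE dx' ey') -scalerAl -scalerAr.
  rewrite (tens_mulE _ _ dx ey') !scalerA; congr (_ *: _).
  rewrite !ksignDl !ksignDr [ksign F d' e]ksignC.
  set p := ksign F e d'; set q := ksign F d e; set r := ksign F d e'.
  set s := ksign F d' e'; have pp : p * p = 1 by apply: ksignK.
  by rewrite mulrCA (mulrA p p s) pp mul1r mulrAC.
move=> d t td; rewrite -td; move: t {td}; apply: tens_indh => [|t u ht hu|e e' x y ex ey].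
- rewrite (lin0 (gproj_linear d)) (lin0 tL); exact: homog0.
- rewrite (linD (gproj_linear d)) (linD tL); exact: homogD.
have xyh := homog_pure ex ey.
have [de|de] := eqVneq d (e + e'); last first.
  by rewrite (homog_out xyh de) (lin0 tL); exact: homog0.
rewrite de xyh (tswapE ex ey); apply: homogZ; rewrite addrC.
exact: homog_pure.
Qed.
End Tswap.

Lemma tmap_left (A B A' B' : bgAlgType F) (f : A -> A') (g : B -> B') x :
  bgmorph f -> bgmorph g -> tmap f g (x ⊗ 1)%R = (f x ⊗ 1)%R.
Proof. by move=> [[fL _ _] _] [[gL g1 _] _]; rewrite tmapE // g1. Qed.

Lemma tmap_right (A B A' B' : bgAlgType F) (f : A -> A') (g : B -> B') y :
  bgmorph f -> bgmorph g -> tmap f g (1 ⊗ y)%R = (1 ⊗ g y)%R.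
Proof. by move=> [[fL f1 _] _] [[gL _ _] _]; rewrite tmapE // f1. Qed.

(** The unit of a tensor product is 1 ⊗ 1. *)
Lemma tassoc_unit (A B C : bgAlgType F) (z : C) :
  @tassoc F A B C (1 ⊗ z)%R = (1 ⊗ (1 ⊗ z))%R.
Proof. exact: tassocE. Qed.

Lemma tswap_left (A B : bgAlgType F) d (x : A) : homog d x ->
  @tswap F A B (x ⊗ 1)%R = (1 ⊗ x)%R.
Proof. by move=> dx; rewrite (tswapE dx (homog1 B)) ksign0r scale1r. Qed.

Lemma tswap_right (A B : bgAlgType F) d (y : B) : homog d y ->
  @tswap F A B (1 ⊗ y)%R = (y ⊗ 1)%R.
Proof. by move=> dy; rewrite (tswapE (homog1 A) dy) ksign0l scale1r. Qed.
End TensorMorphisms.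

(** * The decomposition maps *)

Section Decomposition.
Variable F : fieldType.
Notation R := (Ralg F).

Lemma Rmap_Rvar (I J : finType) (f : I -> J) c i j : injective f ->
  Rmap f (Rvar F c i j) = Rvar F c (f i) (f j).
Proof.
move=> fI; have [->|ij] := eqVneq i j; last exact: Rmap_var.
by rewrite !Rvar_diag; case: (Rmap_bgmorph F fI) => -[/lin0].
Qed.

Section Theta.
Variables I J : finType.
Notation T := (R (option I) ⊗ R J)%type.

Definition outer_var (c : bool) (x y : option I) : T := (Rvar F c x y ⊗ 1)%R.
Definition inner_var (c : bool) (x y : J) : T := (1 ⊗ Rvar F c x y)%R.

Definition Theta_var : bool -> I + J -> I + J -> T := glue outer_var inner_var.

Definition Theta : R (I + J)%type -> T := Rlift Theta_var.

Lemma Theta_var_family : Rfamily Theta_var.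
Proof.
apply: Rfamily_glue.
- exact: (Rfamily_morph (incl_left_morph (R (option I)) (R J)) (@Rvar_family F _)).
- exact: (Rfamily_morph (incl_right_morph (R (option I)) (R J)) (@Rvar_family F _)).
move=> c x y d z t; have := incl_comm (Rvar_homog F c x y) (Rvar_homog F d z t).
suff -> : ksign F (Posz c, Posz 1) (Posz d, Posz 1) = signb F c d by [].
by rewrite /ksign /signb; case: c d => [] [].
Qed.

Lemma Theta_Rvar c x y : Theta (Rvar F c x y) = Theta_var c x y.
Proof. exact: Rlift_var Theta_var_family c x y. Qed.

Lemma Theta_bgmorph : bgmorph Theta.
Proof.
apply: (Rlift_bgmorph Theta_var_family) => c x y.
have hl i i' : homog ((Posz (c : bool), Posz 1) : bideg) (outer_var c i i').
  by rewrite -[(_, _)]addr0; apply: homog_pure (Rvar_homog _ _ _ _) (homog1 _).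
have hr j j' : homog ((Posz (c : bool), Posz 1) : bideg) (inner_var c j j').
  by rewrite -[(_, _)]add0r; apply: homog_pure (homog1 _) (Rvar_homog _ _ _ _).
by case: x y => [x|x] [y|y]; [exact: hl.. | exact: hr].
Qed.

Lemma Theta_spec : is_Theta Theta.
Proof. by split=> [|c]; [case: Theta_bgmorph | split=> *; rewrite Theta_Rvar]. Qed.

Lemma is_Theta_unique theta : is_Theta theta -> theta =1 Theta.
Proof.
move=> [thA thV]; have [[thL _ _] [ThL _ _]] := (thA, Theta_bgmorph.1).
apply: Rext thA Theta_bgmorph.1 _ => c x y.
have [->|xy] := eqVneq x y; first by rewrite !Rvar_diag (lin0 thL) (lin0 ThL).
rewrite Theta_Rvar; have [ii jj ij] := thV c.
case: x y xy => [x|x] [y|y] xy.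
- by apply: ii; apply: contraNneq xy => ->.
- exact: ij.
(* The generators c_{j,i} are not listed: antisymmetry gives their images. *)
- have RR := @Rvar_family F.
  rewrite (rf_anti (RR _)) (rf_anti Theta_var_family c (inl y) (inr x)).
  by rewrite -scaleN1r (linZ thL) ij scaleN1r.
- by apply: jj; apply: contraNneq xy => ->.
Qed.
End Theta.
End Decomposition.

(** * The cooperad identities *)

Section Coherence.
Variable F : fieldType.
Notation R := (Ralg F).

Lemma Theta_natural (I I' J J' : finType) (f : I -> I') (g : J -> J') :
  bijective f -> bijective g -> forall x : R (I + J)%type,
  Theta (Rmap (sum_map f g) x) = tmap (Rmap (omap f)) (Rmap g) (Theta x).
Proof.
move=> /bij_inj fI /bij_inj gI.
have oI : injective (omap f) by move=> [x|] [y|] //= [/fI ->].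
have sI : injective (sum_map f g).
  by move=> [x|x] [y|y] //= => -[]; [move/fI-> | move/gI->].
have oM := Rmap_bgmorph F oI; have gM := Rmap_bgmorph F gI.
have [[oL o1 _] _] := oM; have [[gL g1 _] _] := gM.
apply: Rext => [||c x y].
- exact: algmorph_comp (Rmap_bgmorph F sI).1 (Theta_bgmorph F _ _).1.
- exact: algmorph_comp (Theta_bgmorph F _ _).1 (tmap_algmorph oM gM).
rewrite (Rmap_Rvar F c x y sI) !Theta_Rvar.
case: x y => [x|x] [y|y];
  by rewrite /Theta_var /= /outer_var /inner_var (tmapE _ _ oL gL) ?o1 ?g1 Rmap_Rvar.
Qed.

Lemma optA_inj (I J : Type) : injective (@optA I J).
Proof. by move=> [[x|x]|] [[y|y]|] //= []-> . Qed.

Lemma optAC_inj (I J : Type) : injective (@optAC I J).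
Proof. by move=> [[x|x]|] [[y|y]|] //= []->. Qed.

Lemma optC_inj (I : Type) : injective (@optC I).
Proof. by move=> [[x|]|] [[y|]|] //= []->. Qed.

Lemma sumA_inj (I J K : Type) : injective (@sumA I J K).
Proof. by move=> [[x|x]|x] [[y|y]|y] //= []->. Qed.

Lemma sumAC_inj (I J K : Type) : injective (@sumAC I J K).
Proof. by move=> [[x|x]|x] [[y|y]|y] //= []->. Qed.

Lemma Theta_seq (I J K : finType) (x : R (I + J + K)%type) :
  tassoc (tmap (fun y => Theta (Rmap (@optA I J) y)) id (Theta x)) =
  tmap id (@Theta F J K) (Theta (Rmap (@sumA I J K) x)).
Proof.
pose h (y : R (option (I + J))) := Theta (Rmap (@optA I J) y).
have hM : bgmorph h.
  exact: bgmorph_comp (Rmap_bgmorph F (@optA_inj I J)) (Theta_bgmorph F I (option J)).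
have hV c p q : h (Rvar F c p q) = Theta_var F c (optA p) (optA q).
  by rewrite /h Rmap_Rvar ?Theta_Rvar //; apply: optA_inj.
have sI := @sumA_inj I J K.
have idM (A : bgAlgType F) : bgmorph (@id A) by [].
change (tassoc (tmap h id (Theta x)) =
  tmap id (@Theta F J K) (Theta (Rmap (@sumA I J K) x))).
clearbody h; move: x.
apply: (@Rext F _ _ (fun x => tassoc (tmap h id (Theta x)))
  (fun x => tmap id (@Theta F J K) (Theta (Rmap (@sumA I J K) x)))) => [||c x y].
- apply: algmorph_comp (tassoc_algmorph _ _ _).
  exact: algmorph_comp (Theta_bgmorph F _ _).1 (tmap_algmorph hM (idM _)).
- apply: algmorph_comp (tmap_algmorph (idM _) (Theta_bgmorph F J K)).
  exact: algmorph_comp (Rmap_bgmorph F sI).1 (Theta_bgmorph F _ _).1.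
rewrite (Rmap_Rvar F c x y sI) !Theta_Rvar.
case: x y => [[x|x]|x] [[y|y]|y].
all: rewrite /Theta_var /= /outer_var /inner_var.
(* Only when both indices are in K (case 9) does the first decomposition send the
   generator to the second factor. *)
1-8: rewrite (tmap_left _ hM (idM _)) hV /Theta_var /= /outer_var /inner_var tassocE.
9: rewrite (tmap_right _ hM (idM _)) tassoc_unit.
1-4, 7: rewrite (tmap_left _ (idM _) (Theta_bgmorph F J K)) //.
all: by rewrite (tmap_right _ (idM _) (Theta_bgmorph F J K)) Theta_Rvar.
Qed.

Lemma Theta_par (I J K : finType) (x : R (I + J + K)%type) :
  tassoc (tmap (fun y => Theta (Rmap (@optAC I J) y)) id (Theta x)) =
  tmap (Rmap (@optC I)) (@tswap F (R K) (R J))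
    (tassoc (tmap (fun y => Theta (Rmap (@optAC I K) y)) id
      (Theta (Rmap (@sumAC I J K) x)))).
Proof.
pose h (J' : finType) (y : R (option (I + J'))) := Theta (Rmap (@optAC I J') y).
have hM J' : bgmorph (h J').
  exact: bgmorph_comp (Rmap_bgmorph F (@optAC_inj I J')) (Theta_bgmorph F _ _).
have hV J' c p q : h J' (Rvar F c p q) = Theta_var F c (optAC p) (optAC q).
  by rewrite /h Rmap_Rvar ?Theta_Rvar //; apply: optAC_inj.
have sI := @sumAC_inj I J K.
have idM (A : bgAlgType F) : bgmorph (@id A) by [].
have oM := Rmap_bgmorph F (@optC_inj I).
have tM := tswap_bgmorph (R K) (R J).
change (tassoc (tmap (h J) id (Theta x)) =
  tmap (Rmap (@optC I)) (@tswap F (R K) (R J))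
    (tassoc (tmap (h K) id (Theta (Rmap (@sumAC I J K) x))))).
clearbody h; move: x.
apply: (@Rext F _ _ (fun x => tassoc (tmap (h J) id (Theta x)))
  (fun x => tmap (Rmap (@optC I)) (@tswap F (R K) (R J))
    (tassoc (tmap (h K) id (Theta (Rmap (@sumAC I J K) x)))))) => [||c x y].
- apply: algmorph_comp (tassoc_algmorph _ _ _).
  exact: algmorph_comp (Theta_bgmorph F _ _).1 (tmap_algmorph (hM J) (idM _)).
- apply: algmorph_comp (tmap_algmorph oM tM).
  apply: algmorph_comp (tassoc_algmorph _ _ _).
  apply: algmorph_comp (tmap_algmorph (hM K) (idM _)).
  exact: algmorph_comp (Rmap_bgmorph F sI).1 (Theta_bgmorph F _ _).1.
have oV d p q := Rmap_Rvar F d p q (@optC_inj I).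
rewrite (Rmap_Rvar F c x y sI) !Theta_Rvar.
case: x y => [[x|x]|x] [[y|y]|y].
all: rewrite /Theta_var /= /outer_var /inner_var.
(* The symmetry acts on a nontrivial factor only when both indices are in K
   (case 9) or both in J (case 5). *)
9: rewrite (tmap_right _ (hM J) (idM _)) tassoc_unit (tmap_left _ (hM K) (idM _)) hV.
9: rewrite /Theta_var /= /outer_var /inner_var tassocE (tmap_right _ oM tM).
9: by rewrite (tswap_left _ (Rvar_homog F c x y)).
5: rewrite (tmap_left _ (hM J) (idM _)) hV.
5: rewrite (tmap_right _ (hM K) (idM _)) /Theta_var /= /outer_var /inner_var.
5: rewrite tassocE tassoc_unit (tmap_right _ oM tM).
5: by rewrite (tswap_right _ (Rvar_homog F c x y)).
all: rewrite (tmap_left _ (hM J) (idM _)) (tmap_left _ (hM K) (idM _)) !hV.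
all: rewrite /Theta_var /= /outer_var /inner_var !tassocE.
all: by rewrite (tmap_left _ oM tM) oV.
Qed.
End Coherence.

Theorem proposition7 (R : realType) :
  exists Theta : forall I J : finType,
      Ralg R[i] (I + J)%type -> (Ralg R[i] (option I) ⊗ Ralg R[i] J)%type,
    (forall I J : finType,
       is_Theta (Theta I J) /\
       (forall theta, is_Theta theta -> theta =1 Theta I J)) /\
    cooperad_structure (P := Rspecies R[i]) Theta.
Proof.
exists (@Theta R[i]); split=> [I J|].
  by split; [exact: Theta_spec | exact: is_Theta_unique].
split=> [I J|I I' J J' f g|I J K|I J K].
- exact: Theta_bgmorph.
- exact: Theta_natural.
- exact: Theta_seq.
- exact: Theta_par.
Qed.
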